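(* Let $\mathbf K'_1$ be the class of barycentric subdivisions of cliques (complete graphs, finite or infinite) with at least four vertices, and let $\mathbf K_1$ be the class of right-angled Coxeter groups whose Coxeter graph is in $\mathbf K'_1$. Then $(\mathbf K_1,\preccurlyeq)$ is a finitary abstract elementary class.
   Context: The barycentric subdivision $\hat\Gamma$ of a graph $\Gamma=(V,E)$ has vertex set the disjoint union of $V$ and $\{c_{a,b}: aEb\}$, with $N(c_{a,b})=\{a,b\}$ and $N(a)=\{c_{a,b}: aEb\}$ for $a\in V$. A right-angled Coxeter group has a presentation with generating set $S$ (Coxeter basis) and only relations $s^2=e$, $(ss')^2=e$ for some pairs of distinct $s,s'\in S$; its Coxeter graph has vertex set $S$, distinct vertices adjacent iff they commute. $A\preccurlyeq B$ iff $A$ is a subgroup of $B$ and some Coxeter basis $S$ of $B$ has $A\cap S$ a Coxeter basis of $A$. An abstract elementary class (AEC) is a pair $(\mathbf K,\preccurlyeq)$ with $\mathbf K,\preccurlyeq$ closed under isomorphism, $\preccurlyeq$ a partial order refining substructure, closed under unions of increasing continuous $\preccurlyeq$-chains (each member $\preccurlyeq$ the union, and the union $\preccurlyeq$ any common $\preccurlyeq$-extension), coherent ($A\preccurlyeq C$, $B\preccurlyeq C$, $A\subseteq B\Rightarrow A\preccurlyeq B$), with a Löwenheim–Skolem number. It is finitary if $\mathrm{LS}=\omega$, it has arbitrarily large models, amalgamation, joint embedding, and finite character: whenever $A\subseteq B$ and for every finite $X\subseteq A$ there is a $\preccurlyeq$-embedding $f_X:A\to B$ fixing $X$ pointwise,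 then $A\preccurlyeq B$. *)

(* Defs.v *)
From HB Require Import structures.
From mathcomp Require Import all_boot.
From mathcomp Require Import all_classical.
From mathcomp Require wochoice.

Set Implicit Arguments.
Unset Strict Implicit.
Unset Printing Implicit Defensive.

Local Open Scope classical_set_scope.
Local Open Scope card_scope.
Local Open Scope group_scope.

Record graph := Graph {
  vertex :> Type;
  adj : vertex -> vertex -> Prop;
  adj_sym : forall x y, adj x y -> adj y x;
  adj_irr : forall x, ~ adj x x }.

Definition graph_iso (X Y : graph) : Prop :=
  exists2 f : X -> Y, bijective f & forall x y, adj x y <-> adj (f x) (f y).

Definition clique (X : graph) : Prop := forall x y : X, x <> y -> adj x y.

(* The vertex c_{a,b} is the unordered pair {a, b}, so c_{a,b} = c_{b,a}. *)
Definition edges (X : graph) : set (set X) :=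
  [set e | exists a b : X, adj a b /\ e = [set a; b]].
Arguments edges : clear implicits.

Definition subdiv_adj (X : graph) (x y : X + edges X) : Prop :=
  match x, y with
  | inl a, inr e => val e a
  | inr e, inl a => val e a
  | _, _ => False
  end.

Lemma subdiv_adj_sym (X : graph) (x y : X + edges X) :
  subdiv_adj x y -> subdiv_adj y x.
Proof. by case: x y => [a|e] [b|e']. Qed.

Lemma subdiv_adj_irr (X : graph) (x : X + edges X) : ~ subdiv_adj x x.
Proof. by case: x => ? []. Qed.

Definition barycentric_subdivision (X : graph) : graph :=
  Graph (@subdiv_adj_sym X) (@subdiv_adj_irr X).

Definition K1' (Y : graph) : Prop :=
  exists X : graph,
    [/\ clique X, [set: 'I_4] #<= [set: X]
      & graph_iso Y (barycentric_subdivision X)].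

(* The letter (x, false) stands for x, and (x, true) for its inverse. *)
Definition word (X : Type) := seq (X * bool).

(* The congruence on words whose quotient is the group < X | R >. *)
Inductive pres_eq (X : Type) (R : set (word X)) : word X -> word X -> Prop :=
| pres_refl w : pres_eq R w w
| pres_sym u v : pres_eq R u v -> pres_eq R v u
| pres_trans u v w : pres_eq R u v -> pres_eq R v w -> pres_eq R u w
| pres_cat u u' v v' :
    pres_eq R u u' -> pres_eq R v v' -> pres_eq R (u ++ v) (u' ++ v')
| pres_cancel x b : pres_eq R [:: (x, b); (x, ~~ b)] [::]
| pres_rel r : R r -> pres_eq R r [::].

Definition eval (G : groupType) (S : set G) (w : word S) : G :=
  \prod_(l <- w) (if l.2 then (val l.1)^-1 else val l.1).

(* Evaluation of words induces an isomorphism from < S | R > onto A. *)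
Definition has_presentation (G : groupType) (A S : set G)
    (R : set (word S)) : Prop :=
  A = range (@eval G S) /\ forall u v, eval u = eval v <-> pres_eq R u v.

Inductive racg_relator (X : Type) (E : X -> X -> Prop) : set (word X) :=
| racg_square s : racg_relator E [:: (s, false); (s, false)]
| racg_comm s t : s <> t -> E s t ->
    racg_relator E [:: (s, false); (t, false); (s, false); (t, false)].

Definition coxeter_basis (G : groupType) (A S : set G) : Prop :=
  exists E : S -> S -> Prop, has_presentation A (racg_relator E).

Definition coxeter_adj (G : groupType) (S : set G) (s t : S) : Prop :=
  s <> t /\ commute (val s) (val t).

Lemma coxeter_adj_sym (G : groupType) (S : set G) (s t : S) :
  coxeter_adj s t -> coxeter_adj t s.
Proof. by case=> st cst; split; [exact/nesym | exact: commute_sym]. Qed.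

Lemma coxeter_adj_irr (G : groupType) (S : set G) (s : S) : ~ coxeter_adj s s.
Proof. by case. Qed.

Definition coxeter_graph (G : groupType) (S : set G) : graph :=
  Graph (@coxeter_adj_sym G S) (@coxeter_adj_irr G S).

Definition subgroup (G : groupType) (A : set G) : Prop := group_closed [in A].

Definition K1 (G : groupType) (A : set G) : Prop :=
  exists2 S : set G, coxeter_basis A S & K1' (coxeter_graph S).

Definition coxeter_le (G : groupType) (A B : set G) : Prop :=
  [/\ subgroup A, subgroup B, A `<=` B
    & exists2 S, coxeter_basis B S & coxeter_basis A (A `&` S)].

(* Abstract elementary classes in the language of groups.  A structure is a   *)
(* subgroup A of some ambient group G, and inclusions of structures are       *)
(* inclusions between subgroups of one ambient group.  The ambient group      *)
(* carries no information, as classes are closed under isomorphisms between   *)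
(* subgroups of different groups; a chain of groups lives in its own union.   *)
Definition group_class := forall G : groupType, set G -> Prop.
Definition group_class_rel := forall G : groupType, set G -> set G -> Prop.

Definition morph_on (G H : groupType) (A : set G) (f : G -> H) : Prop :=
  {in A &, {morph f : x y / x * y}}.

Definition group_iso (G H : groupType) (A : set G) (B : set H)
    (f : G -> H) : Prop :=
  morph_on A f /\ set_bij A B f.

Definition strict (I : Type) (R : rel I) (j i : I) : Prop := R j i /\ j <> i.

Definition limit_index (I : Type) (R : rel I) (i : I) : Prop :=
  (exists j, strict R j i) /\
  forall j, strict R j i -> exists2 k, strict R j k & strict R k i.

Section AEC.
Variables (K : group_class) (le : group_class_rel).
Implicit Types G H : groupType.

Definition strong_embedding G H (A : set G) (B : set H) (f : G -> H) : Prop :=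
  [/\ morph_on A f, set_inj A f & le (f @` A) B].

Definition continuous_chain (I : Type) (R : rel I) G (A : I -> set G) : Prop :=
  [/\ forall i, K (A i),
      forall j i, strict R j i -> le (A j) (A i)
    & forall i, limit_index R i -> A i = \bigcup_(j in strict R ^~ i) A j].

(* |C| <= |X| + |L| + kappa; the language L of groups is finite, so |L| is    *)
(* absorbed by the infinite cardinal kappa.                                   *)
Definition LS_property (kappa : Type) : Prop :=
  forall G (A X : set G), K A -> X `<=` A ->
  exists C : set G,
    [/\ K C, X `<=` C, le C A & C #<= [set: (X + kappa)%type]].

Definition LS_number (kappa : Type) : Prop :=
  [/\ infinite_set [set: kappa], LS_property kappa
    & forall lambda : Type, infinite_set [set: lambda] ->
      LS_property lambda -> [set: kappa] #<= [set: lambda]].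

Record is_AEC : Prop := {
  aec_subgroup : forall G (A : set G), K A -> subgroup A;
  aec_iso : forall G H (A : set G) (B : set H) f,
    group_iso A B f -> K A -> K B;
  aec_le_iso : forall G H (A B : set G) (C : set H) f,
    K A -> K B -> group_iso B C f -> le A B -> le (f @` A) C;
  aec_le_sub : forall G (A B : set G), K A -> K B -> le A B -> A `<=` B;
  aec_le_refl : forall G (A : set G), K A -> le A A;
  aec_le_anti : forall G (A B : set G), K A -> K B ->
    le A B -> le B A -> A = B;
  aec_le_trans : forall G (A B C : set G), K A -> K B -> K C ->
    le A B -> le B C -> le A C;
  aec_chain : forall (I : Type) (R : rel I) G (A : I -> set G),
    inhabited I -> wochoice.well_order R -> continuous_chain R A ->
    [/\ K (\bigcup_i A i),
        forall j, le (A j) (\bigcup_i A i)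
      & forall B : set G, K B -> (forall i, le (A i) B) ->
        le (\bigcup_i A i) B];
  aec_coherent : forall G (A B C : set G), K A -> K B -> K C ->
    le A C -> le B C -> A `<=` B -> le A B;
  aec_LS : exists kappa : Type, LS_number kappa }.

Definition arbitrarily_large : Prop :=
  forall X : Type, exists G (A : set G), K A /\ [set: X] #<= A.

Definition amalgamation : Prop :=
  forall G0 G1 G2 (A : set G0) (B : set G1) (C : set G2) f g,
    K A -> K B -> K C -> strong_embedding A B f -> strong_embedding A C g ->
  exists G3 (D : set G3) f' g',
    [/\ K D, strong_embedding B D f', strong_embedding C D g'
      & {in A, f' \o f =1 g' \o g}].

Definition joint_embedding : Prop :=
  forall G1 G2 (B : set G1) (C : set G2), K B -> K C ->
  exists G3 (D : set G3) f g,
    [/\ K D, strong_embedding B D f & strong_embedding C D g].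

Definition finite_character : Prop :=
  forall G (A B : set G), K A -> K B -> A `<=` B ->
  (forall X : set G, finite_set X -> X `<=` A ->
   exists2 f : G -> G, strong_embedding A B f & {in X, f =1 id}) ->
  le A B.

Record finitary_AEC : Prop := {
  finitary_is_AEC : is_AEC;
  finitary_LS : LS_number nat;
  finitary_large : arbitrarily_large;
  finitary_amalgamation : amalgamation;
  finitary_joint_embedding : joint_embedding;
  finitary_finite_character : finite_character }.

End AEC.

(* Main.v *)
(* Let (W, T) be a right-angled Coxeter system. The set of walls crossed an
   odd number of times by a gallery depends only on its end points, which
   yields the exchange condition, the fact that descents of an element
   commute, the centralisers of generators and the normal form of involutions.

   Rigidity: if S is another Coxeter basis of W whose graph is the subdivision
   of a clique with at least four vertices, then T is conjugate to S. Each s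
   in S is a reflection of (W, T), because its centraliser has centre {1, s},
   and commuting elements of S are simultaneously conjugate into T. For each s
   the generators that do not commute with s form a connected graph, so that
   their walls all lie on one side of the wall of s, the positive one. There
   is a chamber x on the positive side of all walls; by a ping-pong argument
   it is the only one, hence x T x^-1 is contained in S.

   Consequently a basis of a strong subgroup A extends to a basis of B, and the
   extension is unique since three vertices have a trivial common centraliser.
   Transitivity, unions of chains and finite character follow by gluing bases;
   coherence uses the retraction onto a standard subgroup; amalgams are
   subgroups of the group of one large clique. *)
From HB Require Import structures.
From mathcomp Require Import all_boot.
From mathcomp Require Import all_classical.
From mathcomp Require wochoice.
Require Import Defs.

Set Implicit Arguments.
Unset Strict Implicit.
Unset Printing Implicit Defensive.

Local Open Scope classical_set_scope.
Local Open Scope card_scope.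
Local Open Scope group_scope.

(** * Words and the universal property *)

(** The relation [coxeter_le] only asserts that some basis of [B] restricts to a basis of [A], so
    the bases witnessing [A] in [B] and [B] in [C] need not match. Rigidity repairs this because the
    conjugating element lies in the smaller group: conjugating the larger basis by it yields another
    basis of the larger group, now containing the prescribed one. The presentation is exploited
    through a universal property, applied to well-chosen sets with involutions: [bool] gives
    parities of letters, pairs of a reflection and a sign give the wall-crossing cocycle,
    alternating words give infinite dihedral groups, and a group acted on by left multiplication
    gives homomorphisms. Four vertices enter because the subdivision of a triangle is a hexagon,
    where vertices and edges can be exchanged. From four on, a vertex has at least three neighbours
    and an edge only two, so both kinds of generators keep their kind in a larger basis. *)

Section Words.
Variable G : groupType.
Implicit Types (S J : set G) (r s t u x y z : G) (l : seq G).

Definition word_in S l : Prop := forall x, x \in l -> S x.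

Definition prodw l : G := \prod_(x <- l) x.

Definition gen S : set G := [set x | exists2 l, word_in S l & prodw l = x].

Lemma prodw_nil : prodw [::] = 1.
Proof. exact: big_nil. Qed.

Lemma prodw_cons x l : prodw (x :: l) = x * prodw l.
Proof. exact: big_cons. Qed.

Lemma prodw_cat l l' : prodw (l ++ l') = prodw l * prodw l'.
Proof. exact: big_cat. Qed.

Lemma prodw_seq1 x : prodw [:: x] = x.
Proof. by rewrite prodw_cons prodw_nil mulg1. Qed.

Lemma prodw_rcons l x : prodw (rcons l x) = prodw l * x.
Proof. by rewrite -cats1 prodw_cat prodw_seq1. Qed.

Lemma word_in_cons S x l : word_in S (x :: l) <-> S x /\ word_in S l.
Proof.
split=> [h|[Sx Sl] y]; last by rewrite inE => /predU1P[->|/Sl].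
by split=> [|y yl]; apply: h; rewrite inE ?eqxx ?yl ?orbT.
Qed.

Lemma word_in_cat S l l' : word_in S (l ++ l') <-> word_in S l /\ word_in S l'.
Proof.
split=> [h|[Sl Sl'] x]; last by rewrite mem_cat => /orP[/Sl|/Sl'].
by split=> x xl; apply: h; rewrite mem_cat xl ?orbT.
Qed.

Lemma word_in_rcons S l x : word_in S (rcons l x) <-> word_in S l /\ S x.
Proof.
rewrite -cats1 word_in_cat; split=> -[? ?]; split=> //.
  by have /word_in_cons[] : word_in S [:: x] by [].
by apply/word_in_cons.
Qed.

Lemma word_in_sub S J l : J `<=` S -> word_in J l -> word_in S l.
Proof. by move=> JS Jl x /Jl /JS. Qed.

Lemma gen_word S l : word_in S l -> gen S (prodw l).
Proof. by move=> Sl; exists l. Qed.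

Lemma gen1 S : gen S 1.
Proof. by exists [::]; rewrite ?prodw_nil. Qed.

Lemma gen_mem S s : S s -> gen S s.
Proof. by move=> Ss; exists [:: s]; rewrite ?prodw_seq1//; apply/word_in_cons. Qed.

Lemma genM S x y : gen S x -> gen S y -> gen S (x * y).
Proof.
move=> [l Sl <-] [l' Sl' <-]; exists (l ++ l'); rewrite ?prodw_cat//.
by apply/word_in_cat.
Qed.

Lemma gen_sub S J : J `<=` S -> gen J `<=` gen S.
Proof. by move=> JS x [l Jl <-]; exists l => //; exact: word_in_sub Jl. Qed.

Lemma commuteP x y : commute x y <-> x ^ y = x.
Proof. by split=> [/commgP/conjg_fixP|/conjg_fixP/commgP]. Qed.

Lemma commuteJ x y z : commute (x ^ z) (y ^ z) <-> commute x y.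
Proof. by rewrite /commute -!conjMg; split=> [/conjg_inj|->]. Qed.

Lemma commute_prodw x l : (forall y, y \in l -> commute x y) ->
  commute x (prodw l).
Proof.
elim: l => [|y l IH] h; first by rewrite prodw_nil; exact: commute1.
rewrite prodw_cons; apply: commuteM; first by apply: h; rewrite mem_head.
by apply: IH => z zl; apply: h; rewrite inE zl orbT.
Qed.

Lemma prodw_conj l z : prodw [seq y ^ z | y <- l] = prodw l ^ z.
Proof. by rewrite /prodw conjg_prod big_map. Qed.

(* Every action of the generators by commuting involutions of a set [M],    *)
(* prescribed only by the commutations that hold in [G], is an action of    *)
(* the group they generate.                                                 *)
Definition coxeter_system S : Prop :=
  (forall s, S s -> s * s = 1) /\
  forall (M : Type) (f : G -> M -> M),
    (forall s, S s -> involutive (f s)) ->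
    (forall s t, S s -> S t -> commute s t ->
       forall m, f s (f t m) = f t (f s m)) ->
    forall l l', word_in S l -> word_in S l' -> prodw l = prodw l' ->
    forall m, foldr f m l = foldr f m l'.

Definition reduced S l : Prop :=
  word_in S l /\
  forall l', word_in S l' -> prodw l' = prodw l -> size l <= size l'.

Lemma reduced_exists S x : gen S x -> exists2 l, reduced S l & prodw l = x.
Proof.
move=> [l Sl lx]; move: {2}(size l) (leqnn (size l)) => n.
elim: n l Sl lx => [|n IH] l Sl lx ln.
  by exists l => //; split=> // l' _ _; move: ln; rewrite leqn0 => /eqP->.
have [[l' [Sl' l'x l'n]]|nl'] := pselect
  (exists l', [/\ word_in S l', prodw l' = x & size l' < size l]).
  by apply: (IH l') => //; rewrite -ltnS (leq_trans l'n).
exists l => //; split=> // l' Sl' l'l; rewrite leqNgt; apply/negP => l'n.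
by apply: nl'; exists l'; split; rewrite // l'l.
Qed.

Lemma reduced_cons S t l : reduced S (t :: l) -> reduced S l.
Proof.
move=> [/word_in_cons[St Sl] minl]; split=> // l' Sl' l'l.
by have := minl (t :: l'); rewrite !prodw_cons l'l; apply=> //; apply/word_in_cons.
Qed.

End Words.

(** * The wall-crossing cocycle *)

Section Cocycle.
Variable G : groupType.
Implicit Types (S J : set G) (r s t u x y z : G) (l : seq G).

(* [sgw r l] tells whether the gallery [1, l_1, l_1 l_2, ...] crosses the   *)
(* wall of the reflection [r] an odd number of times.                       *)
Fixpoint sgw r l : bool :=
  if l is t :: l' then (r == t) (+) sgw (r ^ t) l' else false.

(** The side of the wall of [r] on which the chamber [x] lies, [false] being the side of the chamber
    1. *)
Definition sg S r x : bool :=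
  `[< exists2 l, word_in S l & prodw l = x /\ sgw r l >].

Lemma sgw_cat r l l' : sgw r (l ++ l') = sgw r l (+) sgw (r ^ prodw l) l'.
Proof.
elim: l r => [|t l IH] r /=; first by rewrite prodw_nil conjg1.
by rewrite IH prodw_cons conjgM addbA.
Qed.

(** At the first crossing, [r] is [u t u^-1] for a prefix [u t] of [l], so multiplying by [r]
    deletes that letter [t]. *)
Lemma exchangew S r l : (forall s, S s -> s * s = 1) -> word_in S l ->
  sgw r l -> exists l', [/\ word_in S l', size l' < size l
    & prodw l' = r * prodw l].
Proof.
move=> S2; elim: l r => //= t l IH r /word_in_cons[St Sl].
have [->|_] := eqVneq r t.
  by move=> _; exists l; split; rewrite // prodw_cons mulgA S2// mul1g.
rewrite addFb => /(IH _ Sl)[l' [Sl' ll' pl']]; exists (t :: l'); split=> //.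
  exact/word_in_cons.
by rewrite !prodw_cons pl' conjgE !mulgA mulgV mul1g.
Qed.

Section System.
Variable S : set G.
Hypothesis hS : coxeter_system S.

Lemma cox_sq s : S s -> s * s = 1.
Proof. by case: hS => h _; exact: h. Qed.

Lemma cox_inv s : S s -> s^-1 = s.
Proof. by move=> /cox_sq; exact: mulg1_eq. Qed.

Lemma cox_conjK s x : S s -> (x ^ s) ^ s = x.
Proof. by move=> Ss; rewrite -conjgM cox_sq// conjg1. Qed.

Lemma word_in_rev l : word_in S l -> word_in S (rev l).
Proof. by move=> Sl x; rewrite mem_rev => /Sl. Qed.

Lemma prodw_rev l : word_in S l -> prodw (rev l) = (prodw l)^-1.
Proof.
elim: l => [|t l IH]; first by rewrite prodw_nil invg1.
move=> /word_in_cons[St Sl]; rewrite rev_cons prodw_rcons IH// prodw_cons.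
by rewrite invgM (cox_inv St).
Qed.

Lemma genV x : gen S x -> gen S x^-1.
Proof.
by move=> [l Sl <-]; exists (rev l); [exact: word_in_rev|exact: prodw_rev].
Qed.

Lemma genJ x y : gen S x -> gen S y -> gen S (x ^ y).
Proof. by move=> hx hy; apply: genM; [exact: genV|exact: genM]. Qed.

Lemma gen_subgroup : subgroup (gen S).
Proof.
split; first by rewrite in_setE; exact: gen1.
by move=> x y; rewrite !in_setE => hx hy; apply: genM => //; exact: genV.
Qed.

(** An action of [J] extends to [S] by letting the other generators act trivially, which respects
    every commutation. *)
Lemma cox_sub J : J `<=` S -> coxeter_system J.
Proof.
move=> JS; split=> [s /JS /cox_sq//|M f finv fcom l l' Jl Jl' ll' m].
case: hS => _ /(_ M (fun s => if `[< J s >] then f s else id)) h.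
have e k : word_in J k ->
    foldr (fun s => if `[< J s >] then f s else id) m k = foldr f m k.
  elim: k => //= s k IH /word_in_cons[Js Jk].
  by rewrite IH// ifT//; exact/asboolP.
rewrite -!e//; apply: h => //; try exact: word_in_sub JS _.
  by move=> s Ss; case: asboolP => // Js; exact: finv.
move=> s t Ss St st n; case: asboolP => Js; case: asboolP => // Jt.
exact: fcom.
Qed.

(** Let [t] flip [bool] and the other generators fix it. These parities are the coordinates of the
    abelianisation. *)
Lemma odd_count_ext t l l' : word_in S l -> word_in S l' ->
  prodw l = prodw l' -> odd (count_mem t l) = odd (count_mem t l').
Proof.
move=> Sl Sl' ll'; case: hS => _ /(_ bool (fun s b => (s == t) (+) b)) h.
have e k : foldr (fun s b => (s == t) (+) b) false k = odd (count_mem t k).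
  by elim: k => //= s k ->; rewrite oddD oddb.
rewrite -!e; apply: h => //.
  by move=> s _ b; rewrite addbA addbb.
by move=> s u _ _ _ b; rewrite addbCA.
Qed.

Lemma cox_neq1 s : S s -> s <> 1.
Proof.
move=> Ss s1; have : odd (count_mem s [:: s]) = odd (count_mem s [::]).
  apply: odd_count_ext => //; first by apply/word_in_cons.
  by rewrite prodw_seq1 prodw_nil.
by rewrite /= eqxx.
Qed.

(** Compare the parities of [s] on both sides of [s x = x t]. *)
Lemma conj_cox_eq s t x : S s -> S t -> gen S x -> s ^ x = t -> s = t.
Proof.
move=> Ss St [l Sl <-] sxt.
have : odd (count_mem s (s :: l)) = odd (count_mem s (rcons l t)).
  apply: odd_count_ext; [by apply/word_in_cons|by apply/word_in_rcons|].
  by rewrite prodw_cons prodw_rcons -sxt -conjgC.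
rewrite -cats1 count_cat /= eqxx addn0 !oddD !oddb addbC => /addbI.
by move=> /esym /eqP.
Qed.

Lemma gen_mem_sub J s : J `<=` S -> S s -> gen J s -> J s.
Proof.
move=> JS Ss [l Jl ls]; have := @odd_count_ext s l [:: s].
rewrite ls prodw_seq1 /= eqxx => h; apply: (Jl); rewrite -has_pred1 has_count.
by apply: odd_gt0; rewrite h//; [exact: word_in_sub Jl|apply/word_in_cons].
Qed.

Lemma sgw_ext r l l' : word_in S l -> word_in S l' -> prodw l = prodw l' ->
  sgw r l = sgw r l'.
Proof.
move=> Sl Sl' ll'.
(* The recursion of [sgw] as an action on reflections with a sign. Since [foldr] lets the last
   letter act first and a gallery is read from its first letter, the words are reversed. *)
pose f (t : G) (m : G * bool) := (m.1 ^ t, (m.1 == t) (+) m.2).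
have e k b : (foldr f (r, b) (rev k)).2 = b (+) sgw r k.
  rewrite -foldl_rev revK; elim: k r b => [|t k IH] q b /=; first by rewrite addbF.
  by rewrite IH addbA [b (+) _]addbC.
have := e l false; have := e l' false; rewrite !addFb => <- <-.
case: hS => _ /(_ _ f) h; congr (_.2); apply: h.
- move=> t St [q b]; rewrite /f/= cox_conjK// addbA; congr (_, _).
  have tt : t ^ t = t by exact/commuteP/commute_refl.
  by rewrite -{2}tt (inj_eq (@conjg_inj _ t)) addbb.
- move=> s t Ss St st [q b]; rewrite /f/= -!conjgM st; congr (_, _).
  have sts : s ^ t = s by exact/commuteP.
  have tst : t ^ s = t by exact/commuteP/commute_sym.
  rewrite -[X in _ == X]sts (inj_eq (@conjg_inj _ t)).
  by rewrite -[X in _ = (_ ^ _ == X) (+) _]tst (inj_eq (@conjg_inj _ s)) addbCA.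
- exact: word_in_rev.
- exact: word_in_rev.
- by rewrite !prodw_rev// ll'.
Qed.

End System.
End Cocycle.

(** * Descents, centralisers and involutions *)

Section SystemTheory.
Variables (G : groupType) (S : set G).
Hypothesis hS : coxeter_system S.
Implicit Types (J : set G) (r s t u x y z : G) (l F : seq G).

Lemma sgE r l : word_in S l -> sg S r (prodw l) = sgw r l.
Proof.
move=> Sl; apply/asboolP/idP => [[l' Sl' [e]]|]; last by exists l.
by rewrite (sgw_ext hS _ Sl' Sl e).
Qed.

Lemma sg1 r : sg S r 1 = false.
Proof. by rewrite -prodw_nil sgE. Qed.

Lemma sg_gen r s : S s -> sg S r s = (r == s).
Proof.
by move=> Ss; rewrite -(prodw_seq1 s) sgE/= ?addbF ?prodw_seq1//; apply/word_in_cons.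
Qed.

Lemma sgM r x y : gen S x -> gen S y ->
  sg S r (x * y) = sg S r x (+) sg S (r ^ x) y.
Proof.
move=> [l Sl <-] [l' Sl' <-]; rewrite -prodw_cat !sgE ?sgw_cat//.
by apply/word_in_cat.
Qed.

Lemma sg_genM r s x : S s -> gen S x ->
  sg S r (s * x) = (r == s) (+) sg S (r ^ s) x.
Proof. by move=> Ss gx; rewrite sgM ?(sg_gen _ Ss)//; exact: gen_mem. Qed.

Lemma sg_Mgen r s x : S s -> gen S x ->
  sg S r (x * s) = sg S r x (+) (r ^ x == s).
Proof. by move=> Ss gx; rewrite sgM ?(sg_gen _ Ss)//; exact: gen_mem. Qed.

Lemma sg_descent s x : S s -> gen S x -> sg S s (s * x) = ~~ sg S s x.
Proof.
move=> Ss gx; have ss : s ^ s = s by exact/commuteP/commute_refl.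
by rewrite sg_genM// eqxx ss.
Qed.

Lemma sg_reflV t x : gen S x -> sg S (t ^ x^-1) x = sg S t x^-1.
Proof.
move=> gx; have gV := genV hS gx; have := sg1 t; rewrite -(mulVg x) sgM//.
by move/negbT; rewrite negb_add => /eqP.
Qed.

(** Along [x^-1 t x], the crossings made by [x^-1] and by [x] cancel, which leaves the one made by
    the middle letter. *)
Lemma sg_refl_self t x : S t -> gen S x -> sg S (t ^ x) (t ^ x).
Proof.
move=> St gx; have gV := genV hS gx; have gt := gen_mem St.
have gtx : gen S (t * x) by exact: genM.
rewrite {2}conjgE sgM// conjgK sg_genM// eqxx.
have -> : t ^ t = t by exact/commuteP/commute_refl.
by rewrite -{1}(invgK x) sg_reflV ?invgK//; case: sg.
Qed.

Lemma sg_refl t x y : S t -> gen S x -> gen S y ->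
  sg S (t ^ x) (t ^ x * y) = ~~ sg S (t ^ x) y.
Proof.
move=> St gx gy; rewrite sgM ?sg_refl_self//; last first.
  by apply: (genJ hS) => //; exact: gen_mem.
by have -> : (t ^ x) ^ (t ^ x) = t ^ x by exact/commuteP/commute_refl.
Qed.

Lemma sg_commute r t x : S t -> gen S x -> commute r (t ^ x) -> r <> t ^ x ->
  sg S r (t ^ x) = false.
Proof.
move=> St gx rt nrt; have gV := genV hS gx; have gt := gen_mem St.
have gtx : gen S (t * x) by exact: genM.
rewrite conjgE sgM// sg_genM//.
have -> : (r ^ x^-1 == t) = false.
  by apply/eqP => e; apply: nrt; rewrite -e conjgKV.
have -> : (r ^ x^-1) ^ t = r ^ x^-1.
  by apply/commuteP; apply/(commuteJ _ _ x); rewrite conjgKV.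
by rewrite addFb -sgM// mulVg sg1.
Qed.

Lemma exchange r l : word_in S l -> sg S r (prodw l) ->
  exists l', [/\ word_in S l', size l' < size l & prodw l' = r * prodw l].
Proof. by move=> Sl; rewrite sgE//; exact: exchangew (cox_sq hS) Sl. Qed.

Lemma reduced_head t l : reduced S (t :: l) -> sg S t (prodw l) = false.
Proof.
move=> [/word_in_cons[St Sl] minl]; apply/negP => /(exchange Sl)[l' [Sl' ll' e]].
by have := minl l' Sl'; rewrite e prodw_cons /= => /(_ erefl); rewrite leqNgt ltnS ltnW.
Qed.

Lemma reduced_sg t l : reduced S (t :: l) -> sg S t (prodw (t :: l)).
Proof.
move=> rl; case: (rl) => /word_in_cons[St Sl] _.
by rewrite prodw_cons sg_descent ?reduced_head//; exact: gen_word.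
Qed.

End SystemTheory.

Section Dihedral.

(* The infinite dihedral group, as alternating words recorded by their first *)
(* letter and the number of the remaining letters.                          *)
Definition dihedral_act (b : bool) (m : option (bool * nat)) :=
  if m is Some (c, n) then
    if c == b then (if n is n'.+1 then Some (~~ b, n') else None)
    else Some (b, n.+1)
  else Some (b, 0).

Lemma dihedral_actK b : involutive (dihedral_act b).
Proof.
by case: b; case=> [[[] [|n]]|].
Qed.

Variables (G : groupType) (S : set G).
Hypothesis hS : coxeter_system S.
Implicit Types (r s t u x y z : G) (l F : seq G).

(** A reduced word in two letters alternates, so the action only ever lengthens the state, which
    then records the first letter and the length. *)
Lemma dihedral_word t u l : S t -> S u -> t <> u -> reduced [set t; u] l ->
  foldr (fun s => if s == t then dihedral_act true else
                  if s == u then dihedral_act false else id) None l =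
  if l is s :: l' then Some (s == t, size l') else None.
Proof.
move=> St Su tu; elim: l => // s l IH rl; have rl' := reduced_cons rl.
rewrite /= (IH rl'); have [/word_in_cons[sD lD] minl] := rl.
have utF : (u == t) = false by apply/eqP/nesym.
case: l IH rl rl' lD minl => [|s' l] IH rl rl' lD minl.
  by case: sD => ->; rewrite ?utF eqxx.
have /word_in_cons[s'D lD'] := lD.
have ss' : s <> s'.
  move=> e; have := minl l lD'; rewrite -e !prodw_cons mulgA.
  rewrite (cox_sq hS) ?mul1g => [/(_ erefl)|]; last by case: sD => ->.
  by rewrite /= leqNgt ltnW.
by case: sD s'D ss' => -> [] -> // _; rewrite ?utF ?eqxx ?utF.
Qed.

(** Reflecting in a wall of the subgroup that separates [x] from 1 shortens the word and stays in
    the coset. The process ends at an element [z] that no such wall separates from 1. *)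
Lemma coset_min t u x : S t -> S u -> gen S x ->
  exists d z, [/\ gen [set t; u] d, gen S z, x = d * z &
    forall s e, [set t; u] s -> gen [set t; u] e -> sg S (s ^ e) z = false].
Proof.
move=> St Su [l Sl <-].
have DS : [set t; u] `<=` S by move=> s [] ->.
have hD := cox_sub hS DS.
move: {2}(size l) (leqnn (size l)) => n; elim: n l Sl => [|n IH] l Sl ln.
  exists 1, 1; split; [exact: gen1|exact: gen1| |by move=> *; exact: (sg1 hS)].
  by move: ln; rewrite leqn0 => /nilP->; rewrite prodw_nil mulg1.
have [[s [e [Ds De h]]]|nh] := pselect (exists s e,
    [/\ [set t; u] s, gen [set t; u] e & sg S (s ^ e) (prodw l)]).
  have [l' [Sl' ll' el']] := exchange hS Sl h.
  have [//||d [z [Dd Sz e' hz]]] := IH l'; first by rewrite -ltnS (leq_trans ll').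
  have De' : gen [set t; u] (s ^ e) by apply: (genJ hD) => //; exact: gen_mem.
  exists ((s ^ e)^-1 * d), z; split=> //; first by apply: genM => //; exact: (genV hD).
  by rewrite -mulgA -e' el' mulKg.
exists 1, (prodw l); split; [exact: gen1|exact: gen_word|by rewrite mul1g|].
by move=> s e Ds De; apply/negP => h; apply: nh; exists s, e.
Qed.

(** In the decomposition [x = d z] of [coset_min], both [t] and [u] are descents of [d], so [d] has
    reduced words starting with either. If [t] and [u] did not commute, the dihedral action would
    exist and send the empty state to two different states. *)
Lemma descents_commute t u x : S t -> S u -> gen S x ->
  sg S t x -> sg S u x -> commute t u.
Proof.
move=> St Su gx tx ux; apply: contrapT => ntu.
have tu : t <> u by move=> e; apply: ntu; rewrite e.
have DS : [set t; u] `<=` S by move=> s [] ->.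
have hD := cox_sub hS DS.
have [d [z [Dd Sz xdz hz]]] := coset_min St Su gx.
have Dt : [set t; u] t by left.
have Du : [set t; u] u by right.
have Sd : gen S d by exact: gen_sub DS _ Dd.
have [l rl ld] := reduced_exists Dd; have [Dl minl] := rl.
have Sl := word_in_sub DS Dl.
have key s : [set t; u] s -> sg S s x -> exists2 l', reduced [set t; u] (s :: l')
    & prodw (s :: l') = d.
  move=> Ds; rewrite xdz (sgM hS)// hz// addbF -ld (sgE hS)// => h.
  have [l' [Dl' ll' e]] := exchangew (cox_sq hD) Dl h.
  have e' : prodw (s :: l') = prodw l.
    by rewrite prodw_cons e mulgA (cox_sq hD)// mul1g.
  exists l'; rewrite ?e' //; split; first by apply/word_in_cons.
  by move=> k Dk; rewrite e' => /(minl _ Dk); apply: leq_trans.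
have [l1 r1 e1] := key t Dt tx; have [l2 r2 e2] := key u Du ux.
case: hS => _ /(_ _ (fun s => if s == t then dihedral_act true else
  if s == u then dihedral_act false else id)) h.
have {h} := h _ _ _ _ _ _ _ None; move=> h.
have : Some (true, size l1) = Some (false, size l2).
  have := dihedral_word St Su tu r1; rewrite eqxx => <-.
  have := dihedral_word St Su tu r2; have -> : (u == t) = false by apply/eqP/nesym.
  move=> <-; apply: h.
  - move=> s _; case: ifP => _; first exact: dihedral_actK.
    by case: ifP => // _; exact: dihedral_actK.
  - move=> s s' _ _ ss' m.
    case: (eqVneq s t) => [est|_]; case: (eqVneq s' t) => [est'|_] //.
    + case: (eqVneq s' u) => // esu'.
      by case: ntu; rewrite -est -esu'.
    + case: (eqVneq s u) => // esu.
      by case: ntu; rewrite -est' -esu; exact: commute_sym.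
    + by case: (eqVneq s u); case: (eqVneq s' u).
  - by case: r1 => /(word_in_sub DS).
  - by case: r2 => /(word_in_sub DS).
  - by rewrite e1 e2.
by [].
Qed.

(** [F] generates a finite standard subgroup, of which [prodw F] is the longest element. *)
Definition spherical F : Prop :=
  [/\ uniq F, word_in S F & {in F &, forall f f', commute f f'}].

Lemma sgw_sphericalP F r : {in F &, forall f f', commute f f'} ->
  sgw r F -> r \in F.
Proof.
elim: F r => //= f F IH r cF; rewrite inE; case: eqVneq => //= _.
have cF' : {in F &, forall f f', commute f f'}.
  by move=> g h gF hF; apply: cF; rewrite inE ?gF ?hF orbT.
move=> /(IH _ cF') rF.
have : commute (r ^ f) f by apply: cF; rewrite inE ?eqxx ?rF ?orbT.
have ff : f ^ f = f by exact/commuteP/commute_refl.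
by rewrite -{2}ff => /commuteJ /commuteP e; rewrite -e.
Qed.

Lemma sgw_spherical F r : {in F &, forall f f', commute f f'} -> uniq F ->
  r \in F -> sgw r F.
Proof.
move=> cF uF rF; suff -> : sgw r F = odd (count_mem r F).
  by rewrite count_uniq_mem// rF.
elim: F {uF} r rF cF => //= f F IH r rF cF; rewrite oddD oddb eq_sym; congr (_ (+) _).
have -> : r ^ f = r by apply/commuteP/cF; rewrite ?mem_head.
have cF' : {in F &, forall f f', commute f f'}.
  by move=> g h gF hF; apply: cF; rewrite inE ?gF ?hF orbT.
have [rF'|rF'] := boolP (r \in F); first exact: IH.
have -> : count_mem r F = 0 by apply/eqP; rewrite -leqn0 leqNgt -has_count has_pred1.
by apply/negP => /(sgw_sphericalP cF'); exact/negP.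
Qed.

(** Let [w] be the element and [u] its first letter. If [u] did not commute with some [f] in [F],
    then [u] would be a descent of [w * prodw F] and [f] one of [prodw F * w]; these are equal,
    against [descents_commute]. So [u] commutes with [F] and can be cancelled. *)
Lemma centraliser_spherical F l : spherical F -> reduced S l ->
  commute (prodw l) (prodw F) ->
  forall u f, u \in l -> f \in F -> commute u f.
Proof.
move=> [uF SF cF]; elim: l => // u l IH rl c.
have [/word_in_cons[Su Sl] _] := rl.
have gl := gen_word Sl; have gF := gen_word SF.
have gul : gen S (prodw (u :: l)) by apply: gen_word; exact/word_in_cons.
have ul := reduced_sg hS rl.
have cu f : f \in F -> commute u f.
  move=> fF; apply: contrapT => nuf; have nuf0 := nuf; have Sf := SF _ fF.
  have flN : sg S f (prodw (u :: l)) = false.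
    by apply/negP => h; apply: nuf; exact: descents_commute gul ul h.
  apply: nuf; apply: (@descents_commute _ _ (prodw (u :: l) * prodw F)) => //.
  - exact: genM.
  - rewrite (sgM hS)// ul (sgE hS)//; case: (boolP (sgw _ _)) => //.
    move=> /(sgw_sphericalP cF) h.
    have e : u = u ^ prodw (u :: l).
      by apply: (conj_cox_eq hS Su _ gul) => //; exact: SF.
    by case: nuf0; apply: cF; rewrite // e.
  - rewrite c (sgM hS)// (sgE hS)// (sgw_spherical cF)//.
    have -> : f ^ prodw F = f by apply/commuteP/commute_prodw => g gF'; exact: cF.
    by rewrite flN.
move=> v f; rewrite inE => /predU1P[->|vl] fF; first exact: cu.
apply: IH => //; first exact: reduced_cons rl.
have cuF : commute u (prodw F) by exact: commute_prodw.
by move: c; rewrite prodw_cons /commute -mulgA => c; apply: (@mulgI _ u);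
  rewrite c mulgA -cuF mulgA.
Qed.

End Dihedral.

Section Involutions.
Variable G : groupType.
Implicit Types (S J : set G) (r s t u x y z w : G) (l F : seq G).

Lemma spherical1 S t : S t -> spherical S [:: t].
Proof.
move=> St; split=> //; first by apply/word_in_cons.
by move=> f f'; rewrite !inE => /eqP-> /eqP->.
Qed.

Lemma spherical_sub S J F : J `<=` S -> spherical J F -> spherical S F.
Proof. by move=> JS [uF JF cF]; split=> //; exact: word_in_sub JF. Qed.

Lemma centraliser_gen S t l : coxeter_system S -> S t -> reduced S l ->
  commute (prodw l) t -> forall u, u \in l -> commute u t.
Proof.
move=> hS St rl; rewrite -{1}(prodw_seq1 t) => c u ul.
by apply: (centraliser_spherical hS (spherical1 St) rl c) => //; rewrite inE.
Qed.

(** Induction on the length, with [t] the first letter of a reduced word. If [t] commutes with [w],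
    then [t w] is an involution of the centraliser of [t], a standard subgroup, and [t] joins its
    normal form. Otherwise [t w t] is shorter. The system varies because the first case passes to a
    subgroup. *)
Lemma involution_conj S w : coxeter_system S -> gen S w -> w * w = 1 ->
  exists F x, [/\ spherical S F, gen S x & w = prodw F ^ x].
Proof.
move=> hS [l Sl <-] {w}; move: {2}(size l) (leqnn (size l)) => n.
elim: n S hS l Sl => [|n IH] S hS l Sl ln ll.
  exists [::], 1; split; [by split|exact: gen1|].
  by move: ln; rewrite leqn0 => /nilP->; rewrite conjg1.
have [k rk kl] := reduced_exists (gen_word Sl).
have kn : size k <= n.+1 by case: rk => _ /(_ l Sl) h; rewrite (leq_trans (h _)).
rewrite -kl in ll *; case: k rk kn {l Sl ln kl} ll => [|t l] rl ln ll.
  by exists [::], 1; split; [split|exact: gen1|rewrite conjg1].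
have [/word_in_cons[St Sl] _] := rl.
set w := prodw (t :: l) in ll *; have wE : w = t * prodw l by exact: prodw_cons.
have gt := gen_mem St; have gl := gen_word Sl.
have gw : gen S w by rewrite wE; exact: genM.
have tt := cox_sq hS St; have wt : sg S t w by exact: (reduced_sg hS rl).
have wl : prodw l = t * w by rewrite wE mulgA tt mul1g.
have [ctw|nctw] := pselect (commute t w).
  pose J := [set u | S u /\ commute u t].
  have JS : J `<=` S by move=> u [].
  have hJ := cox_sub hS JS.
  have clt : commute (prodw l) t.
    by rewrite wl; apply: commute_sym; apply: commuteM.
  have Jl : word_in J l.
    move=> u ul; split; first exact: Sl.
    exact: (centraliser_gen hS St (reduced_cons rl) clt).
  have [||F [x [sF gx lF]]] := IH J hJ l Jl.
  - by rewrite -ltnS.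
  - by rewrite wl -mulgA [w * (t * w)]mulgA -ctw -mulgA ll mulg1.
  have gJc z : gen J z -> commute t z.
    move=> [k Jk <-]; apply: commute_prodw => u /Jk[_]; exact: commute_sym.
  have tx := gJc _ gx; have Sx := gen_sub JS gx.
  have SF : word_in S F by case: sF => _ /(word_in_sub JS).
  exists (t :: F), x; split=> //; last first.
    by rewrite prodw_cons conjMg -lF; have /commuteP -> := tx.
  have [uF JF cF] := sF; split=> /=.
  (* If [t] occurred in [F], it would be a descent of [prodw l], as the signs of [x^-1] and [x]
     cancel; but [t :: l] is reduced. *)
  - rewrite uF andbT; apply/negP => tF; have := reduced_head hS rl.
    have gF := gen_word SF; have gxV := genV hS Sx.
    have tV : t ^ x^-1 = t by apply/commuteP/commuteV.
    have tF' : t ^ prodw F = t by apply/commuteP/gJc; exact: gen_word.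
    rewrite lF conjgE !(sgM hS) ?tV//; last exact: genM.
    rewrite tF' (sgE hS)// (sgw_spherical cF)// -(sg_reflV hS)// tV.
    by case: sg.
  - by apply/word_in_cons.
  - move=> f f'; rewrite !inE => /predU1P[->|fF] /predU1P[->|f'F] //.
    + by apply/commute_sym; case: (JF _ f'F).
    + by case: (JF _ fF).
    + exact: cF.
have wV : w^-1 = w by exact: mulg1_eq.
have tV := cox_inv hS St.
have rE : prodw (rev l) = w * t by rewrite (prodw_rev hS)// wl invgM tV wV.
have [|k [Sk kl kE]] := @exchange _ _ hS t _ (word_in_rev Sl).
  rewrite rE (sg_Mgen hS)// wt /=; apply/eqP => h; apply: nctw.
  exact/commuteP.
rewrite size_rev in kl.
have [//|||F [x [sF gx kF]]] := IH S hS k.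
- exact: leq_trans (ltnW kl) ln.
- rewrite kE rE -!mulgA [t * (t * _)]mulgA tt mul1g [w * (w * _)]mulgA ll mul1g.
  by rewrite tt.
exists F, (x * t); split=> //; first exact: genM.
by rewrite conjgM -kF kE rE conjgE tV !mulgA tt mul1g -mulgA tt mulg1.
Qed.

Lemma conj_spherical S F t x : coxeter_system S -> spherical S F -> S t ->
  gen S x -> prodw F = t ^ x -> F = [:: t].
Proof.
move=> hS [uF SF _] St [k Sk <-] e.
have h f : odd (count_mem f F) = (t == f).
  have : odd (count_mem f (k ++ F)) = odd (count_mem f (t :: k)).
    apply: (odd_count_ext hS); [by apply/word_in_cat|by apply/word_in_cons|].
    by rewrite prodw_cat prodw_cons e -conjgC.
  by rewrite count_cat /= !oddD oddb addbC => /addIb.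
have FE f : (f \in F) = (t == f) by rewrite -h count_uniq_mem// oddb.
case: F uF FE {SF e h} => [|f F] /=; first by move=> _ /(_ t); rewrite eqxx.
move=> /andP[fF _] FE; have := FE f; rewrite mem_head => /esym/eqP tf.
case: F fF FE => [|g F]; first by rewrite tf.
by move=> fF /(_ g); rewrite !inE eqxx orbT => /esym/eqP tg; move: fF;
  rewrite -tf tg mem_head.
Qed.

End Involutions.

(** * Rigidity *)

(* [V] is the set of vertices of the complete graph whose barycentric       *)
(* subdivision is the commutation graph of [S]; [fr_four] says that [V] has *)
(* at least four elements.                                                  *)
Record frame (G : groupType) (S V : set G) : Prop := Frame {
  fr_sub : V `<=` S;
  fr_four : forall k : seq G, size k <= 3 -> exists2 a, V a & a \notin k;
  fr_VV : forall a b, V a -> V b -> commute a b -> a = b;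
  fr_EE : forall c c', S c -> ~ V c -> S c' -> ~ V c' -> commute c c' -> c = c';
  fr_edge : forall a b, V a -> V b -> a <> b ->
    exists c, [/\ S c, ~ V c, commute c a & commute c b];
  fr_ends : forall c, S c -> ~ V c -> exists a b,
    [/\ V a, V b, a <> b, commute c a /\ commute c b
      & forall d, V d -> commute c d -> d = a \/ d = b];
  fr_uniq : forall c c' a b, S c -> ~ V c -> S c' -> ~ V c' ->
    V a -> V b -> a <> b -> commute c a -> commute c b ->
    commute c' a -> commute c' b -> c = c' }.

Section Frame.
Variables (G : groupType) (S V : set G).
Hypothesis fr : frame S V.
Implicit Types (a b c d s u v w : G).

Lemma fr_edge3 c a b d : S c -> ~ V c -> V a -> V b -> V d ->
  a <> b -> a <> d -> b <> d -> commute c a -> commute c b -> ~ commute c d.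
Proof.
move=> Sc Vc Va Vb Vd ab ad bd ca cb cd.
have [a' [b' [Va' Vb' ab' _ h]]] := fr_ends fr Sc Vc.
case: (h a Va ca) (h b Vb cb) (h d Vd cd) => [] ? [] ? [] ?; congruence.
Qed.

(** Two neighbours cut the centre of the centraliser of [s] down to [s]: two edges at a vertex, or
    the two ends of an edge. *)
Lemma fr_star s : S s -> exists u v, [/\ S u, S v, commute s u, commute s v
  & forall w, S w -> commute w s -> commute w u -> commute w v -> w = s].
Proof.
move=> Ss; have [Vs|Vs] := pselect (V s).
  have [//|b Vb] := fr_four fr (k := [:: s]); rewrite !inE => /eqP bs.
  have [//|d Vd] := fr_four fr (k := [:: s; b]).
  rewrite !inE => /norP[/eqP ds /eqP db].
  have [u [Su Vu us ub]] := fr_edge fr Vs Vb (nesym bs).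
  have [v [Sv Vv vs vd]] := fr_edge fr Vs Vd (nesym ds).
  exists u, v; split=> //; try exact: commute_sym.
  move=> w Sw ws wu wv; have [Vw|Vw] := pselect (V w); first exact: (fr_VV fr).
  have wu' := fr_EE fr Sw Vw Su Vu wu; have wv' := fr_EE fr Sw Vw Sv Vv wv.
  case: (@fr_edge3 w s b d) => //; try exact: nesym.
    by rewrite wu'.
  by rewrite wv'.
have [a [b [Va Vb ab [ca cb] _]]] := fr_ends fr Ss Vs.
exists a, b; split=> //; try exact: (fr_sub fr).
move=> w Sw ws wa wb; have [Vw|Vw] := pselect (V w); last exact: (fr_EE fr).
by case: ab; rewrite -(fr_VV fr Vw Va wa) -(fr_VV fr Vw Vb wb).
Qed.

(** Connectedness of the generators that do not commute with [s], put as an induction principle to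
    avoid paths. *)
Lemma fr_connected s : S s -> exists2 s0, S s0 /\ ~ commute s s0 &
  forall Q : G -> Prop,
    (forall s' s'', S s' -> S s'' -> ~ commute s s' -> ~ commute s s'' ->
       commute s' s'' -> Q s' -> Q s'') ->
    Q s0 -> forall s', S s' -> ~ commute s s' -> Q s'.
Proof.
move=> Ss; have VS := fr_sub fr; have [Vs|Vs] := pselect (V s).
  have [//|b Vb] := fr_four fr (k := [:: s]); rewrite !inE => /eqP bs.
  have nsV d : V d -> d <> s -> ~ commute s d.
    by move=> Vd ds /(fr_VV fr Vs Vd); exact: nesym.
  exists b; first by split; [exact: VS|exact: nsV].
  move=> Q hQ Qb.
  have QV d : V d -> d <> s -> Q d.
    move=> Vd ds; have [->//|db] := pselect (d = b).
    have [c [Sc Vc cd cb]] := fr_edge fr Vd Vb db.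
    have nsc : ~ commute s c.
      by move=> /commute_sym; apply: (fr_edge3 Sc Vc Vd Vb Vs).
    apply: (hQ c) => //; [exact: VS|exact: nsV|].
    by apply: (hQ b) => //; [exact: VS|exact: nsV].
  move=> c Sc nsc; have [Vc|Vc] := pselect (V c).
    by apply: QV => // cs; apply: nsc; rewrite cs.
  have [a [d [Va Vd ad [ca cd] _]]] := fr_ends fr Sc Vc.
  have nas : a <> s by move=> e; apply: nsc; rewrite -e; exact: commute_sym.
  by apply: (hQ a) => //; [exact: VS|exact: nsV|exact: QV].
have [a [b [Va Vb ab [sa sb] hs]]] := fr_ends fr Ss Vs.
have [//|d Vd] := fr_four fr (k := [:: a; b]).
rewrite !inE => /norP[/eqP da /eqP db].
have nsd : ~ commute s d by move=> /(hs d Vd)[].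
exists d; first by split=> //; exact: VS.
move=> Q hQ Qd.
have QV e : V e -> ~ commute s e -> Q e.
  move=> Ve nse; have [->//|ed] := pselect (e = d).
  have [c [Sc Vc ce cd]] := fr_edge fr Ve Vd ed.
  have nsc : ~ commute s c by move=> /(fr_EE fr Ss Vs Sc Vc) e'; apply: nsd; rewrite e'.
  apply: (hQ c) => //; first exact: VS.
  by apply: (hQ d) => //; exact: VS.
move=> c Sc nsc; have [Vc|Vc] := pselect (V c); first exact: QV.
have [a' [b' [Va' Vb' ab' [ca cb] _]]] := fr_ends fr Sc Vc.
(* At most one end of [c] commutes with [s], since an edge is determined by its ends; the other end
   leads to [c]. *)
have [sa'|nsa'] := pselect (commute s a'); last first.
  by apply: (hQ a') => //; [exact: VS|exact: QV].
have nsb' : ~ commute s b'.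
  move=> sb'; apply: nsc.
  by rewrite (fr_uniq fr Ss Vs Sc Vc Va' Vb' ab' sa' sb' ca cb).
by apply: (hQ b') => //; [exact: VS|exact: QV].
Qed.

End Frame.

Section Rigidity.
Variables (G : groupType) (S V T : set G).
Hypotheses (hS : coxeter_system S) (fr : frame S V) (hT : coxeter_system T).
Hypothesis genST : gen S = gen T.
Implicit Types (a b c d r s t u v w x y z : G) (l F : seq G).

Lemma genT_S s : S s -> gen T s.
Proof. by move=> Ss; rewrite -genST; exact: gen_mem. Qed.

(* If [s] is conjugate to a product of commuting generators [f] of [T], then *)
(* each [f] is conjugate to a central element of the centraliser of [s],     *)
(* which has centre [{1, s}].                                                *)
Lemma conj_into s : S s -> exists2 x, gen T x & T (s ^ x).
Proof.
move=> Ss; have [F [x [sF gx sE]]] := involution_conj hT (genT_S Ss) (cox_sq hS Ss).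
have [uF TF cF] := sF.
have [u [v [Su Sv su sv star]]] := fr_star fr Ss.
have gxV := genV hT gx.
have key f : f \in F -> f ^ x = s.
  move=> fF; have gf := gen_mem (TF _ fF).
  have cent y : S y -> commute s y -> commute (f ^ x) y.
    move=> Sy sy; have gy : gen T (y ^ x^-1) by apply: (genJ hT) => //; exact: genT_S.
    have [l rl ly] := reduced_exists gy.
    have : commute (prodw l) (prodw F).
      by apply/(commuteJ _ _ x); rewrite ly conjgKV -sE; exact: commute_sym.
    move=> /(centraliser_spherical hT sF rl) h.
    rewrite -(conjgKV x y) -ly; apply/commuteJ/commute_prodw => w wl.
    by apply/commute_sym/h.
  have gz : gen S (f ^ x) by rewrite genST; exact: (genJ hT).
  have [l rl lz] := reduced_exists gz; have [Sl minl] := rl.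
  have ls w : w \in l -> w = s.
    move=> wl; apply: star => //; first exact: Sl.
    - by apply: (centraliser_gen hS Ss rl) => //; rewrite lz; apply: cent.
    - by apply: (centraliser_gen hS Su rl) => //; rewrite lz; apply: cent.
    - by apply: (centraliser_gen hS Sv rl) => //; rewrite lz; apply: cent.
  (* A reduced word whose letters all equal [s] has at most one letter, and it is not empty because
     [f] is not 1. *)
  rewrite -lz; case: l ls rl Sl minl lz => [|w [|w' l]] ls rl Sl minl lz.
  - case: (cox_neq1 hT (TF _ fF)); apply: (@conjg_inj _ x).
    by rewrite -lz prodw_nil conj1g.
  - by rewrite prodw_seq1; apply: ls; rewrite mem_head.
  - have := minl l; rewrite !prodw_cons mulgA.
    have -> : w' = s by apply: ls; rewrite !inE eqxx orbT.
    have -> : w = s by apply: ls; rewrite !inE eqxx.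
    rewrite (cox_sq hS)// mul1g => h.
    have Sl' : word_in S l by move: Sl => /word_in_cons[_] /word_in_cons[].
    by move: (h Sl' erefl); rewrite /= leqNgt ltnW.
case: F uF {sF cF} TF key sE => [|f F] uF TF key sE.
  by case: (cox_neq1 hS Ss); rewrite sE prodw_nil conj1g.
exists x^-1 => //; rewrite -(key f) ?mem_head// conjgK.
by apply: TF; rewrite mem_head.
Qed.

(** After conjugating [s] to [t] in [T], the conjugate of [s'] is an involution of the standard
    subgroup centralising [t]. Its normal form taken there moves it without disturbing [t], and has
    a single letter because [s'] is also conjugate to [t']. *)
Lemma conj_into_pair s s' : S s -> S s' -> commute s s' ->
  exists x, [/\ gen T x, T (s ^ x) & T (s' ^ x)].
Proof.
move=> Ss Ss' ss'; have [x0 gx0 Tt] := conj_into Ss.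
have [x1 gx1 Tt'] := conj_into Ss'.
set t := s ^ x0 in Tt; set t' := s' ^ x1 in Tt'.
have gw : gen T (s' ^ x0) by apply: (genJ hT) => //; exact: genT_S.
have [l rl lw] := reduced_exists gw; have [Tl _] := rl.
pose J := [set u | T u /\ commute u t].
have JT : J `<=` T by move=> u [].
have Jl : word_in J l.
  move=> u ul; split; first exact: Tl.
  apply: (centraliser_gen hT Tt rl) => //; rewrite lw.
  by apply/commuteJ/commute_sym.
have [||F [y [sF gy wF]]] := involution_conj (w := s' ^ x0) (cox_sub hT JT).
- by rewrite -lw; exact: gen_word.
- by rewrite -conjMg (cox_sq hS)// conj1g.
have cty : commute t y.
  move: gy => [k Jk <-]; apply: commute_prodw => u /Jk[_]; exact: commute_sym.
have gyT := gen_sub JT gy; have gyV := genV hT gyT.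
have gx : gen T (x0 * y^-1) by exact: genM.
exists (x0 * y^-1); split=> //.
  by rewrite conjgM -/t; have /commuteP -> : commute t y^-1 by exact: commuteV.
have e : s' ^ (x0 * y^-1) = prodw F by rewrite conjgM wF conjgK.
have /(conj_spherical hT) h : spherical T F by exact: spherical_sub sF.
rewrite e (h t' (x1^-1 * (x0 * y^-1))) ?prodw_seq1//.
  by apply: genM => //; exact: (genV hT).
by rewrite -e [RHS]conjgM /t' conjgK.
Qed.

(** The wall of [s] bounds the chamber [x]: the chamber [s x] equals [x t] with [t = s ^ x], hence
    is adjacent to [x]. *)
Definition on_wall s x : Prop := gen T x /\ T (s ^ x).

Lemma sgw_off_wall r t l : (forall u, u \in l -> commute u t) ->
  ~ commute r t -> sgw r l = false.
Proof.
elim: l r => //= u l IH r h nrt; have ut : commute u t by apply: h; rewrite mem_head.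
have -> : (r == u) = false by apply/eqP => ru; apply: nrt; rewrite ru.
rewrite addFb IH//; first by move=> v vl; apply: h; rewrite inE vl orbT.
move=> c; apply: nrt; apply/(commuteJ _ _ u).
by have /commuteP -> : commute t u by exact: commute_sym.
Qed.

(** Chambers on the wall of [s'] are joined by a gallery whose letters commute with [s' ^ x]. It
    only crosses walls of reflections commuting with [s'], and that of [s] is not among them. *)
Lemma on_wall_side s s' x y : S s -> S s' -> ~ commute s s' ->
  on_wall s' x -> on_wall s' y -> sg T s x = sg T s y.
Proof.
move=> Ss Ss' ns [gx Tx] [gy Ty]; have gg : gen T (x^-1 * y).
  by apply: genM => //; exact: (genV hT).
have e : (s' ^ x) ^ (x^-1 * y) = s' ^ y by rewrite conjgM conjgK.
have e' := conj_cox_eq hT Tx Ty gg e.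
have [l rl lg] := reduced_exists gg; have [Tl _] := rl.
have -> : y = x * prodw l by rewrite lg mulVKg.
rewrite (sgM hT)//; last exact: gen_word.
rewrite (sgE hT)// (@sgw_off_wall _ (s' ^ x)) ?addbF// => [u ul|]; last first.
  by move/commuteJ.
apply: (centraliser_gen hT Tx rl) => //; rewrite lg.
by apply/commute_sym/commuteP; rewrite e -e'.
Qed.

Lemma wall_exists s : S s -> exists x, on_wall s x.
Proof. by move=> /conj_into[x ? ?]; exists x. Qed.

Lemma positive_side : exists eps : G -> bool, forall s s' x,
  S s -> S s' -> ~ commute s s' -> on_wall s' x -> sg T s x = eps s.
Proof.
suff /choice[eps h] : forall s, exists e, forall s' x,
    S s -> S s' -> ~ commute s s' -> on_wall s' x -> sg T s x = e.
  by exists eps => s s' x; exact: h.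
move=> s; have [Ss|nSs] := pselect (S s); last by exists true => s' x /nSs.
have [s0 [Ss0 ns0] h] := fr_connected fr Ss.
have [x0 w0] := wall_exists Ss0; exists (sg T s x0) => s' x _ Ss' ns' wx.
apply: (h (fun s' => forall x, on_wall s' x -> sg T s x = sg T s x0)) wx => //.
  move=> u v Su Sv nu nv uv Qu y wy.
  (* A chamber on both walls transfers the sign from [u] to [v]. *)
  have [z [gz Tu Tv]] := conj_into_pair Su Sv uv.
  have wvz : on_wall v z by split.
  by rewrite (on_wall_side Ss Sv nv wy wvz); apply: Qu; split.
by move=> y wy; exact: on_wall_side wy w0.
Qed.

Section Chamber.
Variable eps : G -> bool.
Hypothesis epsP : forall s s' x, S s -> S s' -> ~ commute s s' ->
  on_wall s' x -> sg T s x = eps s.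

Definition pos s x : bool := sg T s x == eps s.

Lemma pos_wall s s' x : S s -> S s' -> ~ commute s s' -> on_wall s' x -> pos s x.
Proof. by move=> *; rewrite /pos (epsP (s' := s'))// eqxx. Qed.

Lemma refl_conj s : S s -> exists t x, [/\ T t, gen T x & s = t ^ x].
Proof.
move=> /conj_into[x gx Tx]; exists (s ^ x), x^-1; split=> //; first exact: (genV hT).
by rewrite conjgK.
Qed.

Lemma posS s x : S s -> gen T x -> pos s (s * x) = ~~ pos s x.
Proof.
move=> Ss gx; have [t [y [Tt gy ->]]] := refl_conj Ss.
by rewrite /pos (sg_refl hT)//; case: sg; case: (eps _).
Qed.

Lemma posC s s' x : S s -> S s' -> gen T x -> commute s s' -> s <> s' ->
  pos s (s' * x) = pos s x.
Proof.
move=> Ss Ss' gx ss' ns; have [t [y [Tt gy e]]] := refl_conj Ss'.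
rewrite /pos (sgM hT)//; last exact: genT_S.
rewrite e (sg_commute hT)// -?e// addFb.
by have /commuteP -> : commute s s' by [].
Qed.

(** From a chamber negative for both, no gallery can leave: crossing the wall of [s] takes place at
    a chamber on that wall, which is positive for [s'], and conversely. Yet [s x] is positive for
    [s]. *)
Lemma pos_or s s' x : S s -> S s' -> ~ commute s s' -> gen T x ->
  ~~ pos s x -> pos s' x.
Proof.
move=> Ss Ss' ns gx nx; apply: contrapT => /negP nx'.
have stay l : word_in T l -> ~~ pos s (x * prodw l) /\ ~~ pos s' (x * prodw l).
  elim/last_ind: l => [|l t IH]; first by rewrite prodw_nil mulg1.
  move=> /word_in_rcons[Tl Tt]; have [h h'] := IH Tl.
  have gy : gen T (x * prodw l) by apply: genM => //; exact: gen_word.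
  rewrite prodw_rcons mulgA /pos !(sg_Mgen hT _ Tt gy).
  have -> : (s ^ (x * prodw l) == t) = false.
    apply/eqP => e; move/negP: h'; apply; apply: (@pos_wall s' s) => //.
      by move/commute_sym.
    by split=> //; rewrite e.
  have -> : (s' ^ (x * prodw l) == t) = false.
    apply/eqP => e; move/negP: h; apply; apply: (@pos_wall s s') => //.
    by split=> //; rewrite e.
  by rewrite !addbF; split.
have [l Tl le] : gen T (x^-1 * (s * x)).
  apply: genM; first exact: (genV hT).
  by apply: genM => //; exact: genT_S.
have [] := stay l Tl; rewrite le mulVKg posS// nx.
by [].
Qed.

Lemma pos_wall_vertex a : V a -> exists2 x, on_wall a x & pos a x.
Proof.
move=> Va; have Sa := fr_sub fr Va; have [x [gx Tx]] := wall_exists Sa.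
have [px|nx] := boolP (pos a x); first by exists x.
exists (a * x); last by rewrite posS.
split; first by apply: genM => //; exact: genT_S.
by rewrite conjgM; have /commuteP -> : commute a a by [].
Qed.

(* A chamber on the wall of a vertex [d] and on its positive side is on the *)
(* positive side of all walls, but possibly for one edge [c_{d,e}].         *)
Lemma almost_chamber : exists2 a, V a & exists2 y, gen T y &
  forall c, S c -> ~ V c -> commute c a -> pos c y.
Proof.
have [//|d Vd _] := fr_four fr (k := [::]); have Sd := fr_sub fr Vd.
have [y wy py] := pos_wall_vertex Vd; have gy : gen T y by case: wy.
have [[c [Sc Vc nc]]|h] := pselect (exists c, [/\ S c, ~ V c & ~~ pos c y]).
  have cd : commute c d.
    by apply: contrapT => ncd; move/negP: nc; apply; exact: pos_wall wy.
  have [e1 [e2 [Ve1 Ve2 e12 [ce1 ce2] hc]]] := fr_ends fr Sc Vc.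
  (* An edge at a vertex [a] outside [c] does not commute with [c], hence is positive at [y] by
     [pos_or]. *)
  have [//|a Va] := fr_four fr (k := [:: e1; e2]).
  rewrite !inE => /norP[/eqP a1 /eqP a2].
  exists a => //; exists y => // c' Sc' Vc' c'a.
  apply: (@pos_or c) => // cc'.
  by move: c'a; rewrite -(fr_EE fr Sc Vc Sc' Vc' cc') => /(hc _ Va)[].
exists d => //; exists y => // c Sc Vc _; apply: contrapT => /negP nc.
by apply: h; exists c.
Qed.

(** Walk along the wall of [a], on its positive side, towards the chamber [y] of [almost_chamber]. A
    generator [s] negative at [x] is an edge at [a], so its wall separates [x] from [y]; the chamber
    [s x] is still on the wall of [a] and nearer to [y]. *)
Lemma chamber_exists : exists2 x, gen T x & forall s, S s -> pos s x.
Proof.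
have [a Va [y gy hy]] := almost_chamber; have Sa := fr_sub fr Va.
have [x wx px] := pos_wall_vertex Va.
have [l Tl le] : gen T (x^-1 * y).
  by case: wx => gx _; apply: genM => //; exact: (genV hT).
move: {2}(size l) (leqnn (size l)) => n.
elim: n x wx px l Tl le => [|n IH] x wx px l Tl le ln; have [gx Tx] := wx.
  exists x => // s Ss; apply: contrapT => /negP ns.
  have sa : commute s a.
    by apply: contrapT => nsa; move/negP: ns; apply; exact: pos_wall wx.
  have [Vs|Vs] := pselect (V s); first by move: ns; rewrite (fr_VV fr Vs Va sa) px.
  move: ns; suff -> : x = y by rewrite hy.
  move: ln le; rewrite leqn0 => /nilP->; rewrite prodw_nil => e.
  by rewrite -(mulVKg x y) -e mulg1.
have [//|] := pselect (forall s, S s -> pos s x); first by exists x.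
move=> /existsNP[s /not_implyP[Ss /negP ns]].
have sa : commute s a.
  by apply: contrapT => nsa; move/negP: ns; apply; exact: pos_wall wx.
have [Vs|Vs] := pselect (V s); first by move: ns; rewrite (fr_VV fr Vs Va sa) px.
have as_ : a <> s by move=> e; apply: Vs; rewrite -e.
have [l' [Tl' ll' e']] : exists l', [/\ word_in T l', size l' < size l
    & prodw l' = s ^ x * prodw l].
  apply: (exchange hT) => //; have := hy s Ss Vs sa; move: ns; rewrite /pos le.
  have gxy : gen T (x^-1 * y) by rewrite -le; exact: gen_word.
  have -> : sg T s y = sg T s x (+) sg T (s ^ x) (x^-1 * y).
    by rewrite -(sgM hT)// mulVKg.
  by case: (sg T (s ^ x) _) => //; rewrite addbF => /negP.
apply: (IH (s * x) _ _ l') => //.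
- split; first by apply: genM => //; exact: genT_S.
  by rewrite conjgM; have /commuteP -> : commute a s by exact: commute_sym.
- by rewrite posC//; exact: commute_sym.
- by rewrite e' le invgM conjgE (cox_inv hS Ss) -!mulgA mulVKg.
- by rewrite -ltnS (leq_trans ll' ln).
Qed.

(** The first letter [s'] puts the chamber on the negative side of its own wall. A generator not
    commuting with [s'] is then positive by [pos_or]; the side of any other generator commuting with
    [s'] is not affected by [s'], and induction applies. *)
Lemma pingpong x s l : gen T x -> (forall s, S s -> pos s x) -> reduced S l ->
  S s -> sg S s (prodw l) = false -> pos s (prodw l * x).
Proof.
move=> gx hx; elim: l s => [|s' l IH] s rl Ss; first by rewrite prodw_nil mul1g => _; exact: hx.
have [/word_in_cons[Ss' Sl] _] := rl; have gl := gen_word Sl.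
have glx : gen T (prodw l * x) by apply: genM => //; rewrite -genST.
have p' : pos s' (prodw l * x).
  by apply: IH => //; [exact: reduced_cons rl|exact: reduced_head hS _ _ rl].
have n' : ~~ pos s' (prodw (s' :: l) * x) by rewrite prodw_cons -mulgA posS// p'.
have gslx : gen T (prodw (s' :: l) * x).
  by rewrite prodw_cons -mulgA; apply: genM => //; exact: genT_S.
have [ss'|ns] := pselect (commute s s'); last first.
  by move=> _; apply: (@pos_or s') => // /commute_sym.
have [->|nss] := pselect (s = s'); first by rewrite (reduced_sg hS rl).
rewrite prodw_cons (sg_genM hS)//; have -> : (s == s') = false by exact/eqP.
have /commuteP -> := ss'; rewrite addFb => h.
by rewrite -mulgA posC//; apply: IH => //; exact: reduced_cons rl.
Qed.

End Chamber.

Theorem rigidity : exists2 g, gen S g & T = [set s ^ g | s in S].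
Proof.
have [eps epsP] := positive_side.
have [x gx hx] := chamber_exists epsP.
(* The first letter [s] of a reduced word in [S] for [g] is negative at [g x = x t] and positive at
   [x]. The only wall between these adjacent chambers is that of [g], so [g = s]. *)
have sub t : T t -> S (t ^ x^-1).
  move=> Tt; set g := t ^ x^-1.
  have gg : gen S g.
    by rewrite genST; apply: (genJ hT); [exact: gen_mem|exact: (genV hT)].
  have [l rl lg] := reduced_exists gg; case: l rl lg => [|s l] rl lg.
    case: (cox_neq1 hT Tt); apply: (@conjg_inj _ x^-1).
    by rewrite -/g -lg prodw_nil conj1g.
  have [/word_in_cons[Ss Sl] _] := rl.
  have glx : gen T (prodw l * x) by apply: genM => //; rewrite -genST; exact: gen_word.
  have : ~~ pos eps s (g * x).
    rewrite -lg prodw_cons -mulgA posS//.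
    by rewrite (pingpong epsP gx hx (reduced_cons rl))//; exact: reduced_head hS _ _ rl.
  have -> : g * x = x * t by rewrite /g conjgE invgK -mulgA mulgVK.
  rewrite /pos (sg_Mgen hT)//; have := hx s Ss; rewrite /pos => /eqP ->.
  have [e _|_] := eqVneq (s ^ x) t; last by rewrite addbF eqxx.
  by rewrite /g -e conjgK.
exists x; first by rewrite genST.
apply/seteqP; split=> [t Tt|_ [s Ss <-]]; first by exists (t ^ x^-1); rewrite ?conjgKV; auto.
(* A word in [T] for [s ^ x] conjugates back to a word in [J] for [s], and a subset of [S] contains
   every element of [S] that it generates. *)
pose J := [set s | S s /\ T (s ^ x)].
suff : J s by case.
apply: (gen_mem_sub hS) => //; first by move=> ? [].
have [l Tl ls] : gen T (s ^ x) by apply: (genJ hT) => //; exact: genT_S.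
exists [seq t ^ x^-1 | t <- l]; last by rewrite prodw_conj ls conjgK.
by move=> _ /mapP[t tl ->]; split; [exact/sub/Tl|rewrite conjgKV; exact: Tl].
Qed.

End Rigidity.

(** * Presented groups *)

Section Presented.
Variables (X : choiceType) (R : set (word X)).
Implicit Types u v w : seq (X * bool).

Definition preq u v : bool := `[< pres_eq R u v >].

Lemma preq_equiv : equiv_class_of preq.
Proof.
split.
- by move=> u; apply/asboolP; exact: pres_refl.
- by move=> u v; apply/asboolP/asboolP; exact: pres_sym.
- by move=> v u w /asboolP uv /asboolP vw; apply/asboolP; exact: pres_trans vw.
Qed.

Canonical preq_equivRel := EquivRelPack preq_equiv.

Definition pgroup : Type := {eq_quot preq_equivRel}%qT.

HB.instance Definition _ := Choice.on pgroup.

Definition pword u : pgroup := (\pi u)%qT.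

Lemma pwordP u v : pword u = pword v <-> pres_eq R u v.
Proof.
by rewrite /pword; split=> [/eqmodP/asboolP|h]//; apply/eqmodP/asboolP.
Qed.

Lemma pword_surj (x : pgroup) : exists u, x = pword u.
Proof. by exists (repr x); rewrite /pword reprK. Qed.

Definition invw u : seq (X * bool) := rev [seq (p.1, ~~ p.2) | p <- u].

Lemma pres_invl u : pres_eq R (invw u ++ u) [::].
Proof.
elim: u => [|[x b] u IH]; first exact: pres_refl.
rewrite /invw /= rev_cons cat_rcons -/(invw u).
apply: pres_trans IH; apply: pres_cat (pres_refl _ _) _.
rewrite -[u in X in pres_eq _ _ X]cat0s -/([:: (x, ~~ b); (x, b)] ++ u).
apply: pres_cat (pres_refl _ _).
by have := @pres_cancel _ R x (~~ b); rewrite negbK.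
Qed.

Lemma invwK u : invw (invw u) = u.
Proof.
rewrite /invw map_rev revK -map_comp -[RHS]map_id; apply: eq_map => -[x b] /=.
by rewrite negbK.
Qed.

Lemma pres_inv u v : pres_eq R u v -> pres_eq R (invw u) (invw v).
Proof.
move=> uv.
have uV : pres_eq R (u ++ invw u) [::] by have := pres_invl (invw u); rewrite invwK.
have vV : pres_eq R (invw v ++ u) [::].
  exact: pres_trans (pres_cat (pres_refl _ _) uv) (pres_invl v).
have h1 := pres_cat (pres_refl R (invw v)) uV; rewrite cats0 in h1.
apply: pres_sym; apply: pres_trans (pres_sym h1) _; rewrite catA.
by have := pres_cat vV (pres_refl R (invw u)); rewrite cat0s.
Qed.

Definition pmul (x y : pgroup) : pgroup := pword (repr x ++ repr y).
Definition pinv (x : pgroup) : pgroup := pword (invw (repr x)).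

Lemma pres_repr u : pres_eq R (repr (pword u)) u.
Proof. by apply/pwordP; rewrite /pword reprK. Qed.

Lemma pmulE u v : pmul (pword u) (pword v) = pword (u ++ v).
Proof. by apply/pwordP/pres_cat; exact: pres_repr. Qed.

Lemma pinvE u : pinv (pword u) = pword (invw u).
Proof. by apply/pwordP/pres_inv/pres_repr. Qed.

Lemma pmulA : associative pmul.
Proof.
move=> x y z; have [u ->] := pword_surj x; have [v ->] := pword_surj y.
by have [w ->] := pword_surj z; rewrite !pmulE catA.
Qed.

Lemma pmul1 : left_id (pword [::]) pmul.
Proof. by move=> x; have [u ->] := pword_surj x; rewrite pmulE. Qed.

Lemma pmulx1 : right_id (pword [::]) pmul.
Proof. by move=> x; have [u ->] := pword_surj x; rewrite pmulE cats0. Qed.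

Lemma pmulV : left_inverse (pword [::]) pinv pmul.
Proof.
by move=> x; have [u ->] := pword_surj x; rewrite pinvE pmulE; apply/pwordP/pres_invl.
Qed.

Lemma pmulxV : right_inverse (pword [::]) pinv pmul.
Proof.
move=> x; have [u ->] := pword_surj x; rewrite pinvE pmulE; apply/pwordP.
by have := pres_invl (invw u); rewrite invwK.
Qed.

HB.instance Definition _ := isGroup.Build pgroup pmulA pmul1 pmulx1 pmulV pmulxV.

Definition letter (x : X) : pgroup := pword [:: (x, false)].

Lemma pwordM u v : pword (u ++ v) = pword u * pword v.
Proof. by rewrite -pmulE. Qed.

End Presented.

(** Exponents are ignored, since a letter acting by an involution acts like its inverse. *)
Lemma pres_foldr (X : Type) (E : X -> X -> Prop) (M : Type) (g : X -> M -> M) u v :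
  (forall x, involutive (g x)) ->
  (forall x y, x <> y -> E x y -> forall m, g x (g y m) = g y (g x m)) ->
  pres_eq (racg_relator E) u v ->
  forall m, foldr (fun p => g p.1) m u = foldr (fun p => g p.1) m v.
Proof.
move=> gK gC; elim=> {u v} //.
- by move=> u v w _ uv _ vw m; rewrite uv.
- by move=> u u' v v' _ uu' _ vv' m; rewrite !foldr_cat vv' uu'.
- by move=> x b m /=; rewrite gK.
- move=> r [s|s t st Est] m /=; first by rewrite gK.
  by rewrite (gC s t)// gK gK.
Qed.

Section RACG.
Variables (X : choiceType) (E : X -> X -> Prop).

Definition racg := pgroup (racg_relator E).
HB.instance Definition _ := Group.on racg.

Definition rletter (x : X) : racg := letter (racg_relator E) x.

Lemma rletter_sq x : rletter x * rletter x = 1.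
Proof. by rewrite /rletter -pwordM; apply/pwordP/pres_rel/racg_square. Qed.

Lemma rletter_word (l : seq racg) : word_in (range rletter) l ->
  exists k : seq X, l = map rletter k.
Proof.
elim: l => [|y l IH]; first by exists [::].
by move=> /word_in_cons[[x _ <-] /IH[k ->]]; exists (x :: k).
Qed.

Lemma prodw_rletter k :
  prodw (map rletter k) = pword (racg_relator E) [seq (x, false) | x <- k].
Proof.
elim: k => [|x k IH] /=; first exact: prodw_nil.
by rewrite prodw_cons IH -pwordM.
Qed.

Lemma rletter_foldr (M : Type) (g : X -> M -> M) k k' :
  (forall x, involutive (g x)) ->
  (forall x y, x <> y -> E x y -> forall m, g x (g y m) = g y (g x m)) ->
  prodw (map rletter k) = prodw (map rletter k') ->
  forall m, foldr g m k = foldr g m k'.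
Proof.
move=> gK gC; rewrite !prodw_rletter => /pwordP /(pres_foldr gK gC) h m.
by have := h m; rewrite !foldr_map.
Qed.

Lemma rletter_commute x y : E x y -> commute (rletter x) (rletter y).
Proof.
move=> Exy; have [->//|xy] := pselect (x = y).
have : prodw (map rletter [:: x; y; x; y]) = 1.
  by rewrite prodw_rletter; apply/pwordP; apply: pres_rel; exact: racg_comm.
rewrite /= !prodw_cons prodw_nil mulg1 => h.
apply: (@mulIg _ (rletter x * rletter y)).
by rewrite -mulgA h -mulgA [rletter x * (rletter x * _)]mulgA rletter_sq mul1g
  rletter_sq.
Qed.

Lemma rletter_system : coxeter_system (range rletter).
Proof.
split=> [_ [x _ <-]|M f fK fC l l']; first exact: rletter_sq.
move=> /rletter_word[k ->] /rletter_word[k' ->] h m; rewrite !foldr_map.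
apply: rletter_foldr h _ => [x|x y _ Exy]; first by apply: fK; exists x.
by apply: fC; [exists x|exists y|exact: rletter_commute].
Qed.

Lemma rletter_inj : injective rletter.
Proof.
move=> x y xy; apply: contrapT => nxy.
have yx : (y == x) = false by apply/eqP/nesym.
pose g (z : X) (b : bool) := (z == x) (+) b.
have : foldr g false [:: x] = foldr g false [:: y].
  apply: rletter_foldr => [z b|z z' _ _ b|]; last by rewrite /= xy.
    by rewrite /g addbA addbb.
  by rewrite /g addbCA.
by rewrite /= /g eqxx yx.
Qed.

(** If [x] and [y] are distinct and unrelated, they may act as the generators of the infinite
    dihedral group while the other letters act trivially; then [x y] and [y x] act differently. *)
Lemma rletter_commuteP x y : commute (rletter x) (rletter y) ->
  [\/ x = y, E x y | E y x].
Proof.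
move=> xy; apply: contrapT => n.
have nxy : x <> y by move=> e; apply: n; constructor 1.
have yx : (y == x) = false by apply/eqP/nesym.
pose g z := if z == x then dihedral_act true else
  if z == y then dihedral_act false else id.
have : foldr g None [:: x; y] = foldr g None [:: y; x]; last first.
  by rewrite /= /g !eqxx yx.
apply: rletter_foldr; last by rewrite /= !prodw_cons prodw_nil !mulg1.
  move=> z; rewrite /g; case: ifP => _; first exact: dihedral_actK.
  by case: ifP => // _; exact: dihedral_actK.
move=> z z' _ Ez m; rewrite /g.
case: (eqVneq z x) => [ez|_]; case: (eqVneq z' x) => [ez'|_] //.
- case: (eqVneq z' y) => // ey.
  by case: n; constructor 2; rewrite -ez -ey.
- case: (eqVneq z y) => // ey.
  by case: n; constructor 3; rewrite -ez' -ey.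
- by case: (eqVneq z y); case: (eqVneq z' y).
Qed.

End RACG.

Section Basis.
Variable G : groupType.
Implicit Types (A S V : set G).

Lemma foldr_vals (M : Type) S (f : G -> M -> M) (m : M) (u : word S) :
  foldr f m [seq val p.1 | p <- u] = foldr (fun p => f (val p.1)) m u.
Proof. by rewrite foldr_map. Qed.

Lemma word_in_vals S (u : word S) : word_in S [seq val p.1 | p <- u].
Proof. by move=> _ /mapP[p _ ->]; exact: set_valP. Qed.

Lemma eval_cons S (p : S * bool) (u : word S) :
  eval (p :: u) = (if p.2 then (val p.1)^-1 else val p.1) * eval u.
Proof. exact: big_cons. Qed.

Lemma eval_nil S : eval ([::] : word S) = 1.
Proof. exact: big_nil. Qed.

Lemma eval_vals S (u : word S) : (forall s, S s -> s * s = 1) ->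
  eval u = prodw [seq val p.1 | p <- u].
Proof.
move=> S2; elim: u => [|[s b] u IH] /=; first by rewrite eval_nil prodw_nil.
rewrite eval_cons prodw_cons IH /=; case: b => //; congr (_ * _).
exact/mulg1_eq/S2/set_valP.
Qed.

Lemma word_lift S l : word_in S l -> exists u : word S, [seq val p.1 | p <- u] = l.
Proof.
elim: l => [|s l IH]; first by exists [::].
move=> /word_in_cons[Ss /IH[u <-]].
by exists ((exist _ s (mem_set Ss), false) :: u).
Qed.

Lemma eval_range S : (forall s, S s -> s * s = 1) -> range (@eval G S) = gen S.
Proof.
move=> S2; apply/seteqP; split=> [_ [u _ <-]|_ [l /word_lift[u <-] <-]].
  by rewrite eval_vals//; apply: gen_word; exact: word_in_vals.
by exists u; rewrite // eval_vals.
Qed.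

Lemma coxeter_basisP A S : coxeter_basis A S <-> coxeter_system S /\ A = gen S.
Proof.
split=> [[E [AE presE]]|[hS ->]].
  have S2 s : S s -> s * s = 1.
    move=> Ss; pose s' : S := exist _ s (mem_set Ss).
    have := (presE [:: (s', false); (s', false)] [::]).2.
    rewrite !eval_cons eval_nil /= mulg1; apply; apply: pres_rel.
    exact: racg_square.
  split; last by rewrite AE; exact: eval_range.
  split=> // M f fK fC l l' /word_lift[u <-] /word_lift[u' <-].
  rewrite -!eval_vals// => /presE h m; rewrite !foldr_vals.
  apply: (@pres_foldr _ _ _ (fun s : S => f (val s)) u u') h m.
    by move=> x; apply: fK; exact: set_valP.
  move=> x y xy Exy; apply: fC; try exact: set_valP.
  have := (presE [:: (x, false); (y, false); (x, false); (y, false)] [::]).2.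
  have /(_ (val x) (set_valP x)) x2 := S2; have /(_ (val y) (set_valP y)) y2 := S2.
  rewrite !eval_cons eval_nil /= mulg1 => h.
  have {}h : val x * (val y * (val x * val y)) = 1.
    by apply: h; apply: pres_rel; exact: racg_comm.
  rewrite /commute; apply: (@mulIg _ (val x * val y)).
  rewrite -mulgA h -mulgA [val x * (val x * _)]mulgA x2 mul1g.
  by rewrite y2.
have S2 := cox_sq hS; pose E (s t : S) := commute (val s) (val t).
exists E; split; first by rewrite eval_range.
have evalM (u v : word S) : eval (u ++ v) = eval u * eval v by exact: big_cat.
move=> u v; split=> [|h]; last first.
  elim: h => {u v} //.
  - by move=> u v w _ -> _ ->.
  - by move=> u u' v v' _ e _ e'; rewrite !evalM e e'.
  - by move=> s b; rewrite !eval_cons eval_nil mulg1 /=; case: b;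
      rewrite /= ?mulgV ?mulVg.
  - move=> r [s|s t st Est]; rewrite !eval_cons eval_nil /= mulg1.
      exact/S2/set_valP.
    have c : val s * val t = val t * val s by [].
    rewrite c [val t * (val t * _)]mulgA (S2 _ (set_valP t)) mul1g.
    exact/S2/set_valP.
rewrite !eval_vals// => uv.
(* The abstract group is the test set: acting by left multiplication, a word sends 1 to its own
   class, so equal products give equivalent words. *)
pose f (g : G) (m : racg E) := if insub g is Some s then rletter E s * m else m.
have fE (s : S) m : f (val s) m = rletter E s * m by rewrite /f valK.
have fP w : foldr f 1 [seq val p.1 | p <- w] = pword (racg_relator E) w.
  elim: w => [|[s b] w IH] //=; rewrite fE IH -[in RHS]cat1s pwordM.
  congr (_ * _); case: b => //.
  have : pword (racg_relator E) [:: (s, true)] * rletter E s = 1.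
    by rewrite /rletter /letter -pwordM; apply/pwordP; exact: pres_cancel.
  move=> /eqP; rewrite mulg_eq1 => /eqP ->.
  exact/esym/mulg1_eq/rletter_sq.
apply/pwordP; rewrite -!fP; case: hS => _ /(_ _ f) h; apply: h uv _.
- move=> s Ss m; have -> : s = val (exist _ s (mem_set Ss) : S) by [].
  by rewrite !fE mulgA rletter_sq mul1g.
- move=> s t Ss St st m.
  have es : s = val (exist _ s (mem_set Ss) : S) by [].
  have et : t = val (exist _ t (mem_set St) : S) by [].
  by rewrite [in LHS]es [in LHS]et [in RHS]es [in RHS]et !fE !mulgA; congr (_ * _);
    apply: rletter_commute; rewrite /E /=.
- exact: word_in_vals.
- exact: word_in_vals.
Qed.

End Basis.

(** In this form, new elements can be picked off one at a time, each distinct from those already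
    named. *)
Definition four (T : eqType) (P : set T) : Prop :=
  forall k : seq T, size k <= 3 -> exists2 a, P a & a \notin k.

Lemma four_ord : four [set: 'I_4].
Proof.
move=> k k3; apply: contrapT => h.
have : size (enum 'I_4) <= size k.
  apply: uniq_leq_size; first exact: enum_uniq.
  by move=> i _; apply: contrapT => /negP ik; apply: h; exists i.
by rewrite size_enum_ord leqNgt ltnS k3.
Qed.

Lemma four_sub (T : eqType) (P Q : set T) : P `<=` Q -> four P -> four Q.
Proof. by move=> PQ fP k /fP[a /PQ Qa ak]; exists a. Qed.

Lemma four_image (T U : eqType) (P : set T) (f : T -> U) :
  set_inj P f -> four P -> four (f @` P).
Proof.
move=> fI fP k k3; have [//|a0 Pa0 _] := fP [::].
have /choice[g gP] : forall u, exists t, (f @` P) u -> P t /\ f t = u.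
  move=> u; have [[t Pt tu]|nu] := pselect ((f @` P) u); first by exists t.
  by exists a0.
have [|a Pa ak] := fP (map g k); first by rewrite size_map.
exists (f a); first by exists a.
apply: contra ak => fak; apply/mapP; exists (f a) => //.
have [Pg e] := gP (f a) (ex_intro2 _ _ a Pa erefl).
by apply: fI; rewrite ?in_setE.
Qed.

Lemma four_card (T : eqType) (P : set T) : four P -> [set: 'I_4] #<= P.
Proof.
move=> fP; have [//|a Pa _] := fP [::]; have [//|b Pb] := fP [:: a].
have [//|c Pc] := fP [:: b; a]; have [//|d Pd] := fP [:: c; b; a].
move=> d3 c2 b1; pose k := [:: d; c; b; a].
have uk : uniq k by rewrite /k /= d3 c2 b1.
have fI : {in [set: 'I_4] &, injective (fun i : 'I_4 => nth a k i)}.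
  by move=> i j _ _ /eqP; rewrite nth_uniq//= => /eqP /val_inj.
rewrite -(card_le_eql (inj_card_eq fI)); apply: subset_card_le => _ [i _ <-].
have : nth a k i \in k by rewrite mem_nth.
by rewrite !inE => /or4P[] /eqP ->.
Qed.

(** * Frames and subdivisions of cliques *)

Section FrameK1.
Variable G : groupType.
Implicit Types (A S V : set G).

Lemma K1'P S : K1' (coxeter_graph S) <-> exists (X : graph) (p : X + edges X -> G),
  [/\ clique X, [set: 'I_4] #<= [set: X], injective p, range p = S
    & forall x y, x <> y -> (commute (p x) (p y) <-> subdiv_adj x y)].
Proof.
split=> [[X [cX X4 [f [g fK gK] fadj]]]|[X [p [cX X4 pI pS padj]]]].
  exists X, (fun x => val (g x)); split=> //.
  - by move=> x y /val_inj /(can_inj gK).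
  - apply/seteqP; split=> [_ [x _ <-]|s Ss]; first exact: set_valP.
    by exists (f (exist _ s (mem_set Ss))); rewrite ?fK.
  - move=> x y xy; have := fadj (g x) (g y); rewrite !gK /= => <-.
    rewrite /adj /= /coxeter_adj; split=> [c|[]//]; split=> //.
    by move=> /(can_inj gK).
exists X; split=> //.
have Sp x : p x \in S by rewrite in_setE -pS; exists x.
have /choice[f fP] : forall s : S, exists x, p x = val s.
  by move=> s; have := set_valP s; rewrite -[X in X _]pS => -[x _ e]; exists x.
exists f.
  exists (fun x => exist _ (p x) (Sp x) : S) => [s|x]; first exact/val_inj/fP.
  by apply: pI; rewrite fP.
move=> s t; rewrite /adj /=; split=> [[st c]|h].
  apply/padj; last by rewrite !fP.
  by move=> e; apply: st; apply: val_inj; rewrite -!fP e.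
have fst : f s <> f t by move=> e; apply: (@subdiv_adj_irr X (f t)); rewrite -{1}e.
split; last by rewrite -!fP; apply/padj.
by move=> e; apply: fst; rewrite e.
Qed.

Lemma K1'_frame S : K1' (coxeter_graph S) -> exists V, frame S V.
Proof.
move=> /K1'P[X [p [cX X4 pI pS padj]]].
have SE s : S s -> exists x, s = p x by rewrite -pS => -[x _ <-]; exists x.
have NV s : S s -> ~ range (p \o inl) s -> exists e, s = p (inr e).
  by move=> /SE[[a|e] ->] h; [case: h; exists a|exists e].
have Sp x : S (p x) by rewrite -pS; exists x.
have NVr e : ~ range (p \o inl) (p (inr e)) by move=> [a _ /pI].
have lr e a : commute (p (inr e)) (p (inl a)) <-> val e a.
  by rewrite padj.
exists (range (p \o inl)); split.
- by move=> _ [a _ <-]; exact: Sp.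
- have /card_leP[i'] := X4.
  pose i (x : 'I_4) : X := val (i' (exist _ x (in_setT x))).
  have iI : injective i.
    move=> x y /val_inj /(@inj _ _ _ i'); rewrite !in_setT => /(_ isT isT).
    by move=> /(congr1 val).
  have : four ((p \o inl \o i) @` [set: 'I_4]).
    by apply: four_image four_ord => x y _ _ /= /pI [] /iI.
  by apply: four_sub => _ [x _ <-]; exists (i x).
- move=> _ _ [a _ <-] [b _ <-] /= c; apply: contrapT => n.
  by apply: ((padj (inl a) (inl b) _).1 c) => e; apply: n; rewrite e.
- move=> c0 c1 Sc0 Vc0 Sc1 Vc1; have [e ->] := NV _ Sc0 Vc0.
  have [e' ->] := NV _ Sc1 Vc1 => c; apply: contrapT => n.
  by apply: ((padj (inr e) (inr e') _).1 c) => e0; apply: n; rewrite e0.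
- move=> _ _ [a _ <-] [b _ <-] ab.
  have adjab : adj a b by apply: cX => e; apply: ab; rewrite e.
  have he : [set a; b] \in edges X by rewrite in_setE; exists a, b.
  exists (p (inr (exist _ [set a; b] he))); split; [exact: Sp|exact: NVr| |].
    by apply/lr; left.
  by apply/lr; right.
- move=> c0 Sc0 Vc0; have [e ->] := NV _ Sc0 Vc0; have [a [b [adjab eE]]] := set_valP e.
  exists (p (inl a)), (p (inl b)); split; [by exists a|by exists b| | |].
  + by move=> /pI[ab]; apply: (@adj_irr X b); rewrite -{1}ab.
  + by split; apply/lr; rewrite eE; [left|right].
  + by move=> _ [d _ <-] /lr; rewrite eE => -[] ->; [left|right].
- move=> c0 c1 _ _ Sc0 Vc0 Sc1 Vc1 [a _ <-] [b _ <-] ab.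
  have [e ->] := NV _ Sc0 Vc0; have [e' ->] := NV _ Sc1 Vc1.
  move=> /lr ea /lr eb /lr e'a /lr e'b.
  have nab : a <> b by move=> e0; apply: ab; rewrite e0.
  have E (e0 : edges X) : val e0 a -> val e0 b -> val e0 = [set a; b].
    have [a' [b' [_ ->]]] := set_valP e0 => -[] /= e1 [] /= e2.
    - by case: nab; rewrite e1 e2.
    - by rewrite e1 e2.
    - by rewrite e1 e2 setUC.
    - by case: nab; rewrite e1 e2.
  by congr (p (inr _)); apply: val_inj;
    rewrite (E e ea eb) (E e' e'a e'b).
Qed.

Lemma frame_K1' S V : frame S V -> K1' (coxeter_graph S).
Proof.
move=> fr; apply/K1'P.
pose X := @Graph V (fun x y => x <> y) (fun x y => @nesym _ x y)
  (fun x h => h erefl).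
have VS := fr_sub fr; have VP (a : V) : V (val a) := set_valP a.
have /choice[q qP] : forall e : edges X, exists c,
    [/\ S c, ~ V c & forall a : V, commute c (val a) <-> val e a].
  move=> e; have [a [b [ab ->]]] := set_valP e.
  have vab : val a <> val b by move/val_inj.
  have [c [Sc Vc ca cb]] := fr_edge fr (VP a) (VP b) vab.
  exists c; split=> // d; split=> [cd|[] ->//].
  apply: contrapT => /not_orP[da db].
  have vda : val a <> val d by move=> /val_inj/esym.
  have vdb : val b <> val d by move=> /val_inj/esym.
  exact: (fr_edge3 fr Sc Vc (VP a) (VP b) (VP d)) cd.
pose p (x : X + edges X) : G := match x with inl a => val a | inr e => q e end.
exists X, p; split=> //.
- by rewrite (card_le_eqr (card_setT V)); exact: four_card (fr_four fr).
- move=> [a|e] [b|e'] /=.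
  + by move=> /val_inj ->.
  + by have [_ n _] := qP e' => e0; case: n; rewrite -e0; exact: VP.
  + by have [_ n _] := qP e => e0; case: n; rewrite e0; exact: VP.
  + have [_ _ h] := qP e; have [_ _ h'] := qP e' => e0; congr inr.
    apply: val_inj; apply/seteqP; split=> a ea.
      by apply/(h' a); rewrite -e0; apply/(h a).
    by apply/(h a); rewrite e0; apply/(h' a).
- apply/seteqP; split=> [_ [[a|e] _ <-]|c Sc] /=; [exact/VS/VP|by have [] := qP e|].
  have [Vc|Vc] := pselect (V c); first by exists (inl (exist _ c (mem_set Vc))).
  have [a [b [Va Vb ab [ca cb] _]]] := fr_ends fr Sc Vc.
  pose a' : V := exist _ a (mem_set Va); pose b' : V := exist _ b (mem_set Vb).
  have he : [set a'; b'] \in edges X.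
    by rewrite in_setE; exists a', b'; split=> // /(congr1 val).
  pose e : edges X := exist (fun x => x \in edges X) _ he.
  exists (inr e) => //=.
  have [Sq Vq h] := qP e.
  apply: (fr_uniq fr Sq Vq Sc Vc Va Vb ab) => //; first by apply/(h a'); left.
  by apply/(h b'); right.
- move=> [a|e] [b|e'] /= xy; split=> //.
  + by move=> /(fr_VV fr (VP a) (VP b)) /val_inj e; apply: xy; rewrite e.
  + by have [_ _ h] := qP e'; move=> /commute_sym /h.
  + by have [_ _ h] := qP e'; move=> /h /commute_sym.
  + by have [_ _ h] := qP e; move=> /h.
  + by have [_ _ h] := qP e; move=> /h.
  + have [Sq Vq h] := qP e; have [Sq' Vq' h'] := qP e'.
    move=> /(fr_EE fr Sq Vq Sq' Vq') e0; apply: xy; congr inr.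
    apply: val_inj; apply/seteqP; split=> a ea.
      by apply/(h' a); rewrite -e0; apply/(h a).
    by apply/(h a); rewrite e0; apply/(h' a).
Qed.

Lemma K1P A : K1 A <-> exists S V,
  [/\ coxeter_system S, frame S V & A = gen S].
Proof.
split=> [[S /coxeter_basisP[hS AE] /K1'_frame[V fr]]|[S [V [hS fr AE]]]].
  by exists S, V.
by exists S; [apply/coxeter_basisP|exact: frame_K1' fr].
Qed.

End FrameK1.

(** * Bases of strong subgroups *)

Section Transport.
Variables (G H : groupType) (S : set G) (f : G -> H).
Hypotheses (hS : coxeter_system S) (fM : morph_on (gen S) f).
Implicit Types (V : set G) (x y : G) (l : seq G).

Lemma morphM x y : gen S x -> gen S y -> f (x * y) = f x * f y.
Proof. by move=> gx gy; apply: fM; rewrite in_setE. Qed.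

Lemma morph1 : f 1 = 1.
Proof.
have := morphM (gen1 S) (gen1 S); rewrite mulg1 -{1}(mulg1 (f 1)).
by move/mulgI.
Qed.

Lemma morph_prodw l : word_in S l -> f (prodw l) = prodw (map f l).
Proof.
elim: l => [|s l IH]; first by rewrite /= !prodw_nil morph1.
move=> /word_in_cons[Ss Sl]; rewrite /= !prodw_cons morphM ?IH//.
  exact: gen_mem.
exact: gen_word.
Qed.

Lemma morph_commute x y : gen S x -> gen S y -> commute x y ->
  commute (f x) (f y).
Proof. by move=> gx gy xy; rewrite /commute -!morphM// xy. Qed.

Lemma word_in_image (l' : seq H) : word_in (f @` S) l' ->
  exists2 l, word_in S l & l' = map f l.
Proof.
elim: l' => [|y l' IH]; first by exists [::].
move=> /word_in_cons[[s Ss <-] /IH[l Sl ->]]; exists (s :: l) => //.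
exact/word_in_cons.
Qed.

Lemma gen_image : gen (f @` S) = f @` gen S.
Proof.
apply/seteqP; split=> [_ [l' /word_in_image[l Sl ->] <-]|_ [_ [l Sl <-] <-]].
  by exists (prodw l); [exact: gen_word|exact: morph_prodw].
exists (map f l); last by rewrite morph_prodw.
by move=> _ /mapP[s sl ->]; exists s => //; exact: Sl.
Qed.

Hypothesis fI : set_inj (gen S) f.

Lemma morph_inj x y : gen S x -> gen S y -> f x = f y -> x = y.
Proof. by move=> gx gy; apply: fI; rewrite in_setE. Qed.

Lemma morph_commuteE x y : S x -> S y -> commute (f x) (f y) -> commute x y.
Proof.
move=> Sx Sy; rewrite /commute -!morphM; try exact: gen_mem.
by apply: morph_inj; apply: genM; exact: gen_mem.
Qed.

Lemma system_image : coxeter_system (f @` S).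
Proof.
split=> [_ [s Ss <-]|M g gK gC _ _ /word_in_image[l Sl ->] /word_in_image[l' Sl' ->]].
  by rewrite -morphM ?(cox_sq hS) ?morph1//; exact: gen_mem.
rewrite -!morph_prodw// => /morph_inj ll' m; rewrite !foldr_map.
case: hS => _ /(_ M (fun s => g (f s))); apply=> //.
- by move=> s Ss; apply: gK; exists s.
- move=> s t Ss St st; apply: gC; [by exists s|by exists t|].
  by apply: morph_commute => //; exact: gen_mem.
- by apply: ll'; exact: gen_word.
Qed.

Lemma frame_image V : frame S V -> frame (f @` S) (f @` V).
Proof.
move=> fr; have VS := fr_sub fr.
have inj x y : S x -> S y -> f x = f y -> x = y.
  by move=> Sx Sy; apply: morph_inj; exact: gen_mem.
have fC x y : S x -> S y -> commute x y -> commute (f x) (f y).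
  by move=> Sx Sy; apply: morph_commute; exact: gen_mem.
have fE s : S s -> ~ (f @` V) (f s) -> ~ V s by move=> Ss n Vs; apply: n; exists s.
have nV s : S s -> ~ V s -> ~ (f @` V) (f s).
  by move=> Ss n [v Vv /(inj _ _ (VS _ Vv) Ss) e]; apply: n; rewrite -e.
split.
- by move=> _ [a Va <-]; exists a => //; exact: VS.
- apply: four_image; last exact: (fr_four fr).
  by move=> x y; rewrite !in_setE => /VS Sx /VS Sy; exact: inj.
- move=> _ _ [a Va <-] [b Vb <-] /(morph_commuteE (VS _ Va) (VS _ Vb)) c.
  by rewrite (fr_VV fr Va Vb c).
- move=> _ _ [c Sc <-] /(fE _ Sc) Vc [c' Sc' <-] /(fE _ Sc') Vc'.
  by move=> /(morph_commuteE Sc Sc') h; rewrite (fr_EE fr Sc Vc Sc' Vc' h).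
- move=> _ _ [a Va <-] [b Vb <-] ab.
  have [|c [Sc Vc ca cb]] := fr_edge fr Va Vb; first by move=> e; apply: ab; rewrite e.
  exists (f c); split; [by exists c|exact: nV| |].
    by apply: fC => //; exact: VS.
  by apply: fC => //; exact: VS.
- move=> _ [c Sc <-] /(fE _ Sc) Vc.
  have [a [b [Va Vb ab [ca cb] h]]] := fr_ends fr Sc Vc.
  exists (f a), (f b); split; [by exists a|by exists b| | |].
  + by move/(inj _ _ (VS _ Va) (VS _ Vb)).
  + by split; apply: fC => //; exact: VS.
  + move=> _ [d Vd <-] /(morph_commuteE Sc (VS _ Vd)) /(h _ Vd)[->|->]; by [left|right].
- move=> _ _ a0 b0 [c Sc <-] /(fE _ Sc) Vc [c' Sc' <-] /(fE _ Sc') Vc'.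
  move=> [a Va <-] [b Vb <-] ab.
  have Sa := VS _ Va; have Sb := VS _ Vb.
  move=> /(morph_commuteE Sc Sa) ca /(morph_commuteE Sc Sb) cb.
  move=> /(morph_commuteE Sc' Sa) c'a /(morph_commuteE Sc' Sb) c'b.
  rewrite (fr_uniq fr Sc Vc Sc' Vc' Va Vb _ ca cb c'a c'b)//.
  by move=> e; apply: ab; rewrite e.
Qed.

End Transport.

(** Through [h], words act on [H] by left multiplication, so the image of a word depends only on its
    product. Values outside [gen S] are arbitrary. *)
Lemma lift_system (G H : groupType) (S : set G) (h : G -> H) :
  coxeter_system S -> (forall s, S s -> h s * h s = 1) ->
  (forall s t, S s -> S t -> commute s t -> commute (h s) (h t)) ->
  exists2 f : G -> H, morph_on (gen S) f & forall s, S s -> f s = h s.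
Proof.
move=> hS h2 hC.
have /choice[f fP] : forall x, exists y, forall l, word_in S l -> prodw l = x ->
    y = prodw (map h l).
  move=> x; have [[l Sl lx]|n] := pselect (gen S x); last first.
    by exists 1 => l Sl lx; case: n; exists l.
  exists (prodw (map h l)) => l' Sl' l'x.
  case: hS => _ /(_ H (fun s m => h s * m)) u.
  have e k : foldr (fun s m => h s * m) 1 k = prodw (map h k).
    by elim: k => [|s k IH] /=; rewrite ?prodw_nil// prodw_cons IH.
  rewrite -!e; apply: u => //; last by rewrite lx.
    by move=> s Ss m; rewrite mulgA h2// mul1g.
  by move=> s t Ss St st m; rewrite !mulgA; congr (_ * _); exact: hC.
exists f.
  move=> x y; rewrite !in_setE => -[l Sl lx] [l' Sl' ly].
  rewrite (fP x l Sl lx) (fP y l' Sl' ly) -prodw_cat -map_cat.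
  by apply: fP; [apply/word_in_cat|rewrite prodw_cat lx ly].
by move=> s Ss; rewrite (fP s [:: s]) ?prodw_seq1//; apply/word_in_cons.
Qed.

Section Bases.
Variable G : groupType.
Implicit Types (A B C S T V : set G) (a b d g s : G).

Lemma conj_morph S g : morph_on (gen S) (fun x => x ^ g).
Proof. by move=> x y _ _; exact: conjMg. Qed.

Lemma conj_set_inj S g : set_inj (gen S) (fun x => x ^ g).
Proof. by move=> x y _ _; exact: conjg_inj. Qed.

Lemma conj_system S g : coxeter_system S -> coxeter_system [set s ^ g | s in S].
Proof.
by move=> hS; exact: system_image hS (conj_morph g) (conj_set_inj (g := g)).
Qed.

Lemma conj_gen S g : coxeter_system S -> gen S g ->
  gen [set s ^ g | s in S] = gen S.
Proof.
move=> hS gg; rewrite (gen_image (conj_morph g)); apply/seteqP; split=> [_ [x gx <-]|x gx].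
  exact: (genJ hS).
exists (x ^ g^-1); last by rewrite conjgKV.
by apply: (genJ hS) => //; exact: (genV hS).
Qed.

(** As [rigidity] starts from a basis with a frame, both bases are compared with such a one. *)
Lemma K1_rigid A S T : K1 A -> coxeter_system S -> A = gen S ->
  coxeter_system T -> A = gen T -> exists2 g, A g & T = [set s ^ g | s in S].
Proof.
move=> /K1P[S0 [V [hS0 fr AE]]] hS AS hT AT.
have [g gg SE] := rigidity hS0 fr hS (etrans (esym AE) AS).
have [h gh TE] := rigidity hS0 fr hT (etrans (esym AE) AT).
rewrite -AE in gg gh; exists (g^-1 * h).
  by rewrite AE in gg gh *; apply: genM => //; exact: (genV hS0).
rewrite SE TE; apply/seteqP; split=> [_ [s Ss <-]|_ [_ [s Ss <-] <-]].
  by exists (s ^ g); [exists s|rewrite conjgM conjgK].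
by exists s; rewrite // conjgM conjgK.
Qed.

Lemma K1_frame A T : K1 A -> coxeter_system T -> A = gen T -> exists V, frame T V.
Proof.
move=> KA hT AT; have /K1P[S [V [hS fr AS]]] := KA.
have [g _ ->] := K1_rigid KA hS AS hT AT.
by exists [set v ^ g | v in V]; exact: frame_image (conj_morph g) (conj_set_inj (g := g)) _ fr.
Qed.

Lemma coxeter_leP A B : coxeter_le A B <-> exists T,
  [/\ coxeter_system T, B = gen T & A = gen (A `&` T)].
Proof.
split=> [[_ _ _ [T /coxeter_basisP[hT BT] /coxeter_basisP[_ AT]]]|[T [hT BT AT]]].
  by exists T.
have sub : A `&` T `<=` T by move=> x [].
have hA := cox_sub hT sub; split.
- by rewrite AT; exact: gen_subgroup.
- by rewrite BT; exact: gen_subgroup.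
- by rewrite AT BT; exact: gen_sub.
- by exists T; apply/coxeter_basisP.
Qed.

Lemma le_of_sub S T : coxeter_system T -> S `<=` T -> coxeter_le (gen S) (gen T).
Proof.
move=> hT ST; apply/coxeter_leP; exists T; split=> //; congr gen.
apply/seteqP; split=> s; first by move=> Ss; split; [exact: gen_mem|exact: ST].
by move=> [gs Ts]; exact: (gen_mem_sub hT).
Qed.

(** The basis [T] of [B] given by strength meets [A] in a basis conjugate to [S] by some [g] in [A];
    conjugating all of [T] by [g] makes it contain [S]. *)
Lemma le_extend A B S : K1 A -> coxeter_le A B -> coxeter_system S -> A = gen S ->
  exists T, [/\ coxeter_system T, B = gen T & S `<=` T].
Proof.
move=> KA /coxeter_leP[T [hT BT AT]] hS AS.
have sub : A `&` T `<=` T by move=> x [].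
have [g Ag SE] := K1_rigid KA (cox_sub hT sub) AT hS AS.
have gg : gen T g by move: Ag; rewrite AT; exact: gen_sub.
exists [set s ^ g | s in T]; split.
- exact: conj_system.
- by rewrite conj_gen.
- by rewrite SE => _ [s [_ Ts] <-]; exists s.
Qed.

(** Were [a] an edge for [T], the edges of [S] from [a] to [b], [d] and [e] would be vertices for
    [T], giving an edge with three ends. Choosing [e] is what calls for four vertices. *)
Lemma frame_vertices S T V V' : frame S V -> frame T V' -> S `<=` T -> V `<=` V'.
Proof.
move=> fS fT ST a Va; apply: contrapT => V'a; have VS := fr_sub fS.
have Ta := ST _ (VS _ Va).
have [//|b Vb] := fr_four fS (k := [:: a]); rewrite !inE => /eqP ba.
have [//|d Vd] := fr_four fS (k := [:: a; b]).
rewrite !inE => /norP[/eqP da /eqP db].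
have [//|e Ve] := fr_four fS (k := [:: a; b; d]).
rewrite !inE !negb_or => /and3P[/eqP ea /eqP eb /eqP ed].
have key x : V x -> x <> a -> exists2 c, [/\ S c, ~ V c, commute c a & commute c x] & V' c.
  move=> Vx xa; have [c [Sc Vc ca cx]] := fr_edge fS Va Vx (nesym xa).
  exists c => //; apply: contrapT => V'c.
  have := fr_EE fT (ST _ Sc) V'c Ta V'a ca => e'; apply: Vc; by rewrite e'.
have [cb [Scb Vcb cba cbb] V'b] := key b Vb ba.
have [cd [Scd Vcd cda cdd] V'd] := key d Vd da.
have [ce [Sce Vce cea cee] V'e] := key e Ve ea.
have dist x y cx cy : V x -> V y -> x <> a -> y <> a -> x <> y -> S cx -> ~ V cx ->
   commute cx a -> commute cx x -> commute cy y -> cx <> cy.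
  move=> Vx Vy xa ya xy Scx Vcx cxa cxx cyy e'; rewrite -e' in cyy.
  by apply: (fr_edge3 fS Scx Vcx Va Vx Vy) cyy => //; exact: nesym.
apply: (fr_edge3 fT Ta V'a V'b V'd V'e) (commute_sym cea) => //.
- by apply: (dist b d) => //; exact: nesym.
- by apply: (dist b e) => //; exact: nesym.
- by apply: (dist d e) => //; exact: nesym.
Qed.

Lemma frame_edges S T V V' : frame S V -> frame T V' -> S `<=` T ->
  S `&` V' `<=` V.
Proof.
move=> fS fT ST c [Sc V'c]; apply: contrapT => Vc.
have [a [b [Va _ _ [ca _] _]]] := fr_ends fS Sc Vc.
have V'a := frame_vertices fS fT ST Va.
by apply: Vc; rewrite (fr_VV fT V'c V'a ca).
Qed.

(* Two bases sharing three vertices are conjugate by an element that        *)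
(* centralises these vertices, hence is trivial.                            *)
Lemma basis_uniq S V T a b d : coxeter_system S -> frame S V -> coxeter_system T ->
  gen S = gen T -> V a -> V b -> V d -> a <> b -> a <> d -> b <> d ->
  T a -> T b -> T d -> S = T.
Proof.
move=> hS fr hT ST Va Vb Vd ab ad bd Ta Tb Td; have VS := fr_sub fr.
have [g gg TE] := rigidity hS fr hT ST.
have [l rl lg] := reduced_exists gg.
have cent v : V v -> T v -> forall u, u \in l -> commute u v.
  move=> Vv; have Sv := VS _ Vv; rewrite TE => -[s Ss sg].
  apply: (centraliser_gen hS Sv rl); rewrite lg; apply/commute_sym/commuteP.
  by rewrite -{1}(conj_cox_eq hS Ss Sv gg sg).
suff l0 : l = [::].
  move: TE; rewrite -lg l0 prodw_nil => ->; apply/seteqP; split=> [s Ss|_ [s Ss <-]].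
    by exists s; rewrite ?conjg1.
  by rewrite conjg1.
case: l rl {lg} cent => // u l [/word_in_cons[Su _] _] cent.
have ua := cent a Va Ta u (mem_head _ _); have ub := cent b Vb Tb u (mem_head _ _).
have ud := cent d Vd Td u (mem_head _ _); exfalso.
have [Vu|Vu] := pselect (V u); last exact: (fr_edge3 fr Su Vu Va Vb Vd).
by apply: ab; rewrite -(fr_VV fr Vu Va ua) (fr_VV fr Vu Vb ub).
Qed.

Lemma three_vertices S V : frame S V -> exists a b d,
  [/\ V a, V b & V d] /\ [/\ a <> b, a <> d & b <> d].
Proof.
move=> fr; have [//|a Va _] := fr_four fr (k := [::]).
have [//|b Vb] := fr_four fr (k := [:: a]); rewrite !inE => /eqP ba.
have [//|d Vd] := fr_four fr (k := [:: a; b]).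
rewrite !inE => /norP[/eqP da /eqP db].
by exists a, b, d; split; split=> //; exact: nesym.
Qed.

Lemma extension_uniq B R S T : (exists V, frame R V) -> K1 B -> R `<=` S ->
  R `<=` T -> coxeter_system S -> B = gen S -> coxeter_system T -> B = gen T ->
  S = T.
Proof.
move=> [V fr] KB RS RT hS BS hT BT; have [V' fr'] := K1_frame KB hS BS.
have [a [b [d [[Va Vb Vd] [ab ad bd]]]]] := three_vertices fr.
have VV' := frame_vertices fr fr' RS; have VR := fr_sub fr.
apply: (basis_uniq hS fr' hT _ (VV' _ Va) (VV' _ Vb) (VV' _ Vd)) => //;
  try (by apply: RT; exact: VR).
by rewrite -BS.
Qed.

Lemma K1_le_trans A B C : K1 A -> K1 B -> K1 C ->
  coxeter_le A B -> coxeter_le B C -> coxeter_le A C.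
Proof.
move=> KA KB KC AB BC; have /K1P[S [V [hS fr AS]]] := KA.
have [T [hT BT ST]] := le_extend KA AB hS AS.
have [U [hU CU TU]] := le_extend KB BC hT BT.
by rewrite AS CU; apply: le_of_sub => // s /ST /TU.
Qed.

Lemma K1_le_refl A : K1 A -> coxeter_le A A.
Proof. by move=> /K1P[S [V [hS fr ->]]]; exact: le_of_sub. Qed.

(** The bases [S] and [T] witness the strength of [A] and [B] in [C], and [T] is [S] conjugated by
    [g]. The retraction [f] of [C] onto [B] kills the part of [T] outside [B]. Applied to
    [s g = g (s ^ g)], it replaces [g] by [f g], which lies in [B]; so the part of [S] in [A] is
    contained in a conjugate [U] of [J] that is a basis of [B]. *)
Lemma K1_coherent A B C : K1 A -> K1 B -> K1 C ->
  coxeter_le A C -> coxeter_le B C -> A `<=` B -> coxeter_le A B.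
Proof.
move=> KA KB KC /coxeter_leP[S [hS CS AS]] /coxeter_leP[T [hT CT BT]] AB.
have [g Cg TE] := K1_rigid KC hS CS hT CT.
set J := B `&` T in BT; have JT : J `<=` T by move=> x [].
have hJ := cox_sub hT JT.
pose r x : G := if `[< J x >] then x else 1.
have [||f fM fr] := @lift_system _ _ T r hT.
- move=> s Ts; rewrite /r; case: asboolP => _; last by rewrite mulg1.
  exact: (cox_sq hT).
- move=> s t _ _ st; rewrite /r; case: asboolP => _; last exact/commute_sym/commute1.
  by case: asboolP => // _; exact: commute1.
have fJ x : gen J x -> f x = x.
  move=> [l Jl <-]; rewrite (morph_prodw fM (word_in_sub JT Jl)).
  rewrite -[in RHS](map_id l); congr prodw; apply/eq_in_map => s sl.
  by rewrite fr /r; [rewrite asboolT//; exact: Jl|exact/JT/Jl].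
have gg : gen T g by rewrite -CT.
have fg : gen J (f g).
  move: gg => [l Tl <-]; rewrite (morph_prodw fM Tl).
  exists [seq s <- l | `[< J s >]].
    by move=> s; rewrite mem_filter => /andP[/asboolP].
  elim: l Tl => [|s l IH] /=; first by rewrite prodw_nil.
  move=> /word_in_cons[Ts Tl]; rewrite prodw_cons fr// /r; case: asboolP => _.
    by rewrite prodw_cons IH.
  by rewrite mul1g IH.
pose U := [set s ^ (f g)^-1 | s in J].
have gfg := genV hJ fg.
suff sub : A `&` S `<=` U.
  rewrite AS BT -(conj_gen hJ gfg); apply: le_of_sub => //; exact: conj_system.
move=> s [As Ss]; have Jgs : gen J s by rewrite -BT; exact: AB.
have Tt : T (s ^ g) by rewrite TE; exists s.
have gV := genV hT gg.
have e : s * g = g * s ^ g by rewrite -conjgC.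
have gs := gen_sub JT Jgs; have gt := gen_mem Tt.
have {e} : f s * f g = f g * f (s ^ g) by rewrite -!(morphM fM)// e.
(* If [s ^ g] were outside [J], the retraction would kill it and force [s = 1]. *)
rewrite (fJ _ Jgs) (fr _ Tt) /r; case: asboolP => [Jt e|_]; last first.
  rewrite mulg1 -{2}(mul1g (f g)) => /mulIg s1.
  by case: (cox_neq1 hS Ss).
exists (s ^ g) => //; rewrite conjgE invgK mulgA -e.
by rewrite mulgK.
Qed.

End Bases.

(** * The axioms of an abstract elementary class *)

Section Isomorphism.
Variables (G H : groupType).
Implicit Types (A B : set G) (C : set H) (f : G -> H).

Lemma group_iso_image A C f : group_iso A C f -> C = f @` A.
Proof.
move=> [_ [fAC _ fS]]; apply/seteqP; split; first exact: fS.
by move=> _ [x Ax <-]; exact: fAC.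
Qed.

Lemma K1_image A f : K1 A -> morph_on A f -> set_inj A f -> K1 (f @` A).
Proof.
move=> /K1P[S [V [hS fr ->]]] fM fI; apply/K1P; exists (f @` S), (f @` V).
by split; [exact: system_image|exact: frame_image|rewrite gen_image].
Qed.

Lemma le_image A B f : morph_on B f -> set_inj B f -> coxeter_le A B ->
  coxeter_le (f @` A) (f @` B).
Proof.
move=> fM fI /coxeter_leP[T [hT BT AT]]; rewrite BT in fM fI *.
have sub : A `&` T `<=` T by move=> x [].
have fM' : morph_on (gen (A `&` T)) f.
  by move=> x y; rewrite !in_setE => gx gy; apply: fM; rewrite in_setE; exact: gen_sub sub _ _.
rewrite AT -(gen_image fM') -(gen_image fM); apply: le_of_sub.
  exact: system_image.
by move=> _ [x [_ Tx] <-]; exists x.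
Qed.

End Isomorphism.

Lemma well_order_total (I : Type) (R : rel I) (i j : I) :
  wochoice.well_order R -> [\/ i = j, strict R i j | strict R j i].
Proof.
move=> /(_ [pred x | `[< x = i \/ x = j >]])[].
  by exists i; rewrite inE; left.
move=> z [[/[!inE] zij zmin] _].
have [->|ij] := pselect (i = j); first by constructor 1.
case: zij => zE; rewrite zE in zmin.
  by constructor 2; split=> //; apply: zmin; rewrite inE; right.
constructor 3; split; last exact: nesym.
by apply: zmin; rewrite inE; left.
Qed.

(** * Unions of chains *)

Section Chain.
Variables (G : groupType) (I : Type) (A : I -> set G) (i0 : I).
Hypothesis KA : forall i, K1 (A i).
Hypothesis Atot : forall i j, coxeter_le (A i) (A j) \/ coxeter_le (A j) (A i).
Implicit Types (B : set G).

(** A basis of [A i0] serves as anchor: each [A i] above it has only one basis containing the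
    anchor, so bases chosen independently are automatically increasing. No recursion along the chain
    is required. *)
Lemma chain_base : exists S : I -> set G,
  [/\ forall i, coxeter_le (A i0) (A i) -> coxeter_system (S i) /\ A i = gen (S i),
      forall i j, coxeter_le (A i0) (A i) -> coxeter_le (A i) (A j) -> S i `<=` S j
    & forall B, K1 B -> (forall i, coxeter_le (A i) B) -> exists T,
        [/\ coxeter_system T, B = gen T
          & forall i, coxeter_le (A i0) (A i) -> S i `<=` T]].
Proof.
have /K1P[S0 [V0 [hS0 fr0 A0]]] := KA i0.
have /choice[S SP] : forall i, exists T, coxeter_le (A i0) (A i) ->
    [/\ coxeter_system T, A i = gen T & S0 `<=` T].
  move=> i; have [h|n] := pselect (coxeter_le (A i0) (A i)); last by exists set0.
  by have [T hT] := le_extend (KA i0) h hS0 A0; exists T.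
have fr0' : exists V, frame S0 V by exists V0.
exists S; split.
- by move=> i /SP[].
- move=> i j le0i leij; have [hi Ai S0i] := SP i le0i.
  have le0j := K1_le_trans (KA i0) (KA i) (KA j) le0i leij.
  have [hj Aj S0j] := SP j le0j.
  have [T [hT AT iT]] := le_extend (KA i) leij hi Ai.
  by rewrite (extension_uniq fr0' (KA j) S0j _ hj Aj hT AT)// => s /S0i /iT.
- move=> B KB leB; have [T [hT BT S0T]] := le_extend (KA i0) (leB i0) hS0 A0.
  exists T; split=> // i le0i; have [hi Ai S0i] := SP i le0i.
  have [U [hU BU iU]] := le_extend (KA i) (leB i) hi Ai.
  by rewrite (extension_uniq fr0' KB S0T _ hT BT hU BU)// => s /S0i /iU.
Qed.

Section Union.
Variable S : I -> set G.
Let Q i := coxeter_le (A i0) (A i).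
Hypothesis SP : forall i, Q i -> coxeter_system (S i) /\ A i = gen (S i).
Hypothesis Smono : forall i j, Q i -> coxeter_le (A i) (A j) -> S i `<=` S j.

Let U : set G := \bigcup_(i in [set i | Q i]) S i.

Lemma chain_dir i j : Q i -> Q j -> exists k, [/\ Q k, S i `<=` S k & S j `<=` S k].
Proof.
move=> Qi Qj; case: (Atot i j) => h; [exists j|exists i]; split=> //; exact: Smono.
Qed.

Lemma chain_Q0 : Q i0.
Proof. exact: K1_le_refl. Qed.

Lemma chain_word l : word_in U l -> exists2 k, Q k & word_in (S k) l.
Proof.
elim: l => [|s l IH]; first by exists i0 => //; exact: chain_Q0.
move=> /word_in_cons[[i Qi Ss] /IH[j Qj Sl]].
have [k [Qk ik jk]] := chain_dir Qi Qj; exists k => //.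
by apply/word_in_cons; split; [exact: ik|exact: word_in_sub Sl].
Qed.

Lemma chain_sub i : Q i -> S i `<=` U.
Proof. by move=> Qi s Ss; exists i. Qed.

Lemma chain_system : coxeter_system U.
Proof.
split=> [s [i Qi Ss]|M f fK fC l l' /chain_word[i Qi Sl] /chain_word[j Qj Sl']].
  by have [hi _] := SP Qi; exact: (cox_sq hi).
have [k [Qk ik jk]] := chain_dir Qi Qj; have [[_ h] _] := SP Qk.
apply: h; try (by [exact: word_in_sub Sl|exact: word_in_sub Sl']).
  by move=> s /(chain_sub Qk); exact: fK.
by move=> s t /(chain_sub Qk) Us /(chain_sub Qk) Ut; exact: fC.
Qed.

Lemma chain_gen : gen U = \bigcup_i A i.
Proof.
have sub i : Q i -> A i `<=` gen U.
  by move=> Qi; have [_ ->] := SP Qi; apply: gen_sub; exact: chain_sub.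
apply/seteqP; split=> [_ [l /chain_word[k Qk Sl] <-]|x [i _ Ax]].
  by exists k => //; have [_ ->] := SP Qk; exact: gen_word.
have [Qi|le0] := Atot i0 i; first exact: sub Ax.
by apply: (sub i0 chain_Q0); case: le0 => _ _ h _; exact: h.
Qed.

(** Vertices and edges keep their kind along the chain by [frame_vertices] and [frame_edges], so
    each axiom can be checked inside one member containing the generators involved. *)
Lemma chain_frame : exists V, frame U V.
Proof.
have /choice[V frP] : forall i, exists V, Q i -> frame (S i) V.
  move=> i; have [Qi|n] := pselect (Q i); last by exists set0.
  have [hi Ai] := SP Qi; have [V fr] := K1_frame (KA i) hi Ai.
  by exists V.
pose W : set G := \bigcup_(i in [set i | Q i]) V i.
have nW i s : Q i -> ~ W s -> ~ V i s by move=> Qi n Vs; apply: n; exists i.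
have mono i j : Q i -> Q j -> S i `<=` S j -> V i `<=` V j.
  by move=> Qi Qj; exact: frame_vertices (frP _ Qi) (frP _ Qj).
have VS i : Q i -> V i `<=` S i by move=> Qi; exact: (fr_sub (frP _ Qi)).
have nW' i s : Q i -> S i s -> ~ V i s -> ~ W s.
  move=> Qi Ss nV [j Qj Vs]; have [k [Qk ik jk]] := chain_dir Qi Qj.
  apply: nV; apply: (frame_edges (frP _ Qi) (frP _ Qk) ik); split=> //.
  exact: (mono j k Qj Qk jk).
have WV i s : Q i -> S i s -> W s -> V i s.
  by move=> Qi Ss Ws; apply: contrapT => n; exact: (nW' i s).
have dir2 s t : U s -> U t -> exists k, [/\ Q k, S k s & S k t].
  move=> [i Qi Ss] [j Qj St]; have [k [Qk ik jk]] := chain_dir Qi Qj.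
  by exists k; split=> //; [exact: ik|exact: jk].
have WU : W `<=` U by move=> s [i Qi /(VS _ Qi) Ss]; exists i.
exists W; split.
- exact: WU.
- apply: (@four_sub _ (V i0)); first by move=> s Vs; exists i0 => //; exact: chain_Q0.
  exact: (fr_four (frP _ chain_Q0)).
- move=> a b Wa Wb; have [k [Qk Sa Sb]] := dir2 a b (WU _ Wa) (WU _ Wb).
  by apply: (fr_VV (frP _ Qk)); exact: WV.
- move=> c d Uc nc Ud nd; have [k [Qk Sc Sd]] := dir2 c d Uc Ud.
  by apply: (fr_EE (frP _ Qk)) => //; exact: nW.
- move=> a b Wa Wb ab; have [k [Qk Sa Sb]] := dir2 a b (WU _ Wa) (WU _ Wb).
  have [c [Sc Vc ca cb]] := fr_edge (frP _ Qk) (WV _ _ Qk Sa Wa) (WV _ _ Qk Sb Wb) ab.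
  by exists c; split=> //; [exists k|exact: nW' Vc].
- move=> c [k Qk Sc] nc.
  have [a [b [Va Vb ab [ca cb] _]]] := fr_ends (frP _ Qk) Sc (nW _ _ Qk nc).
  exists a, b; split=> //; [by exists k|by exists k|].
  move=> d [j Qj Vd] cd; have [m [Qm km jm]] := chain_dir Qk Qj.
  apply: contrapT => /not_orP[da db].
  apply: (fr_edge3 (frP _ Qm) (km _ Sc) (nW _ _ Qm nc) _ _ _ ab _ _ ca cb cd).
  + exact: (mono k m).
  + exact: (mono k m).
  + exact: (mono j m).
  + exact: nesym.
  + exact: nesym.
- move=> c d a b Uc nc Ud nd Wa Wb ab ca cb da db.
  have [k [Qk Sc Sd]] := dir2 c d Uc Ud.
  have [j [Qj Sa Sb]] := dir2 a b (WU _ Wa) (WU _ Wb).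
  have [m [Qm km jm]] := chain_dir Qk Qj.
  apply: (fr_uniq (frP _ Qm) _ _ _ _ _ _ ab) => //; try exact: km; try exact: nW.
    by apply: WV => //; exact: jm.
  by apply: WV => //; exact: jm.
Qed.

End Union.

Lemma K1_chain : [/\ K1 (\bigcup_i A i), forall j, coxeter_le (A j) (\bigcup_i A i)
  & forall B, K1 B -> (forall i, coxeter_le (A i) B) ->
      coxeter_le (\bigcup_i A i) B].
Proof.
have [S [SP Smono Sup]] := chain_base.
have hU := chain_system SP Smono; have gU := chain_gen SP Smono.
have [V frU] := chain_frame SP Smono.
have KU : K1 (\bigcup_i A i) by rewrite -gU; apply/K1P; eexists; exists V; split; first exact: hU.
have leU i : coxeter_le (A i0) (A i) -> coxeter_le (A i) (\bigcup_i A i).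
  move=> Qi; rewrite -gU; have [_ {1}->] := SP i Qi.
  by apply: le_of_sub => //; exact: chain_sub.
split=> //.
  move=> j; have [/leU//|j0] := Atot i0 j.
  apply: (K1_le_trans (KA j) (KA i0)) => //.
  exact/leU/K1_le_refl.
move=> B KB /(Sup B KB)[T [hT -> ST]]; rewrite -gU; apply: le_of_sub => //.
by move=> s [i Qi Ss]; exact: ST Ss.
Qed.

End Chain.

(** For each [s] in [S], an embedding fixing [s] and three vertices yields a basis of [B] containing
    these four elements. The three vertices determine that basis, so it is the same for all [s] and
    contains [S]. *)
Lemma K1_finite_character : finite_character K1 coxeter_le.
Proof.
move=> G A B KA KB AB h; have /K1P[S [V [hS fr AS]]] := KA.
have [a [b [d [[Va Vb Vd] [ab ad bd]]]]] := three_vertices fr.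
have VS := fr_sub fr.
have key s : S s -> exists T, [/\ coxeter_system T, B = gen T, T s
    & exists V', [/\ frame T V', V' a, V' b & V' d]].
  move=> Ss; have Sabds : [set a; b; d; s] `<=` S.
    by move=> x [[[]|]|] ->//; exact: VS.
  have [||f [fM fI fle] fid] := h [set a; b; d; s]; first exact: finite_set4.
    by move=> x /Sabds Sx; rewrite AS; exact: gen_mem.
  have fE x : [set a; b; d; s] x -> f x = x by move=> hx; apply: fid; rewrite in_setE.
  have KfA := K1_image KA fM fI; rewrite AS in fM fI KfA fle.
  have hf := system_image hS fM fI; have ff := frame_image fM fI fr.
  have [T [hT BT fT]] := le_extend KfA fle hf (esym (gen_image fM)).
  have [V' fr'] := K1_frame KB hT BT.
  have VV' x : V x -> [set a; b; d; s] x -> V' x.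
    by move=> Vx /fE e; rewrite -e; apply: (frame_vertices ff fr' fT); exists x.
  exists T; split=> //; first by apply: fT; exists s => //; apply: fE; right.
  exists V'; split=> //; apply: VV' => //; left; [left; left|left; right|right] => //.
have [T [hT BT _ [V' [fr' V'a V'b V'd]]]] := key a (VS _ Va).
rewrite AS BT; apply: le_of_sub => // s Ss.
have [T' [hT' BT' T's [V'' [fr'' Va'' Vb'' Vd'']]]] := key s Ss.
have V''T := fr_sub fr''.
suff -> : T = T' by [].
apply: (basis_uniq hT fr' hT' _ V'a V'b V'd) => //; try exact: V''T.
by rewrite -BT.
Qed.

(** * Infinite cardinals *)

Section Comparison.
Variables (T : Type) (A B : set T).

(** A maximal graph of a partial injection exhausts [A] or [B]. *)
Lemma set_comparison :
  (exists2 f : T -> T, set_inj A f & {in A, forall x, B (f x)}) \/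
  (exists2 f : T -> T, set_inj B f & {in B, forall x, A (f x)}).
Proof.
pose P (F : set (T * T)) :=
  [/\ forall x y, F (x, y) -> A x /\ B y,
      forall x y y', F (x, y) -> F (x, y') -> y = y'
    & forall x x' y, F (x, y) -> F (x', y) -> x = x'].
have [|F [[FAB Ffun Finj] Fmax]] := @Zorn_bigcup _ P.
  move=> D DP Dtot; have two p q : (\bigcup_(X in D) X) p -> (\bigcup_(X in D) X) q ->
      exists X, [/\ P X, X p & X q].
    move=> [X DX Xp] [Y DY Yq]; have [XY|YX] := Dtot X Y DX DY.
      by exists Y; split=> //; [exact: DP|exact: XY].
    by exists X; split=> //; [exact: DP|exact: YX].
  split.
  - by move=> x y [X DX Xxy]; have [h _ _] := DP _ DX; exact: h.
  - by move=> x y y' h h'; have [X [[_ h1 _] Xp Xq]] := two _ _ h h'; exact: h1 Xp Xq.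
  - by move=> x x' y h h'; have [X [[_ _ h1] Xp Xq]] := two _ _ h h'; exact: h1 Xp Xq.
have [hA|/existsNP[a /not_implyP[Aa na]]] :=
    pselect (forall a, A a -> exists b, F (a, b)).
  left; have /choice[f fP] : forall a, exists b, A a -> F (a, b).
    move=> a; have [/hA[b Fab]|n] := pselect (A a); first by exists b.
    by exists a.
  exists f; last by move=> x; rewrite in_setE => /fP /FAB[].
  by move=> x y; rewrite !in_setE => /fP Fx /fP Fy e; rewrite e in Fx; exact: Finj Fx Fy.
right; have hB b : B b -> exists a, F (a, b).
  move=> Bb; apply: contrapT => nb; apply: (Fmax (F `|` [set (a, b)])).
    split=> [? ?|h]; first by left.
    by apply: na; exists b; apply: h; right.
  have nF x y : F (x, y) -> x <> a /\ y <> b.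
    by move=> Fxy; split=> e; [apply: na; exists y|apply: nb; exists x]; rewrite -e.
  split.
  - by move=> x y [/FAB//|[-> ->]].
  - move=> x y y' [Fxy|e] [Fxy'|e'].
    + exact: Ffun Fxy Fxy'.
    + by case: ((nF _ _ Fxy).1 (congr1 fst e')).
    + by case: ((nF _ _ Fxy').1 (congr1 fst e)).
    + by rewrite (congr1 snd e : y = b) (congr1 snd e' : y' = b).
  - move=> x x' y [Fxy|e] [Fxy'|e'].
    + exact: Finj Fxy Fxy'.
    + by case: ((nF _ _ Fxy).2 (congr1 snd e')).
    + by case: ((nF _ _ Fxy').2 (congr1 snd e)).
    + by rewrite (congr1 fst e : x = a) (congr1 fst e' : x' = a).
have /choice[f fP] : forall b, exists a, B b -> F (a, b).
  move=> b; have [/hB[a' Fab]|n] := pselect (B b); first by exists a'.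
  by exists b.
exists f; last by move=> x; rewrite in_setE => /fP /FAB[].
by move=> x y; rewrite !in_setE => /fP Fx /fP Fy e; rewrite e in Fx; exact: Ffun Fx Fy.
Qed.

End Comparison.

Section Square.
Variables (T : Type) (i : nat -> T).
Hypothesis iI : injective i.

(* [F] is the graph of an injective operation on its domain [sqdom F]. *)
Definition sqdom (F : set (T * T * T)) : set T := [set x | exists y z, F (x, y, z)].

Definition sqgood (F : set (T * T * T)) : Prop :=
  [/\ forall x y z z', F (x, y, z) -> F (x, y, z') -> z = z',
      forall x y x' y' z, F (x, y, z) -> F (x', y', z) -> x = x' /\ y = y',
      forall x y, sqdom F x -> sqdom F y -> exists z, F (x, y, z)
    & forall x y z, F (x, y, z) -> sqdom F y /\ sqdom F z].

Let F0 : set (T * T * T) :=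
  [set p | exists a b, p = (i a, i b, i (pickle (a, b)))].

Lemma sqgood0 : sqgood F0.
Proof.
split.
- by move=> x y z z' [a [b [-> -> ->]]] [a' [b' [/iI -> /iI -> ->]]].
- move=> x y x' y' z [a [b [-> -> ->]]] [a' [b' [-> ->]]].
  by move=> /iI /(pcan_inj pickleK)[-> ->].
- by move=> x y [_ [_ [a [_ [-> _ _]]]]] [_ [_ [b [_ [-> _ _]]]]]; exists (i (pickle (a, b))), a, b.
- move=> x y z [a [b [_ -> ->]]]; split; first by exists (i b), (i (pickle (b, b))), b, b.
  by eexists _, _, (pickle (a, b)), b.
Qed.

Lemma sq_maximal : exists F, [/\ sqgood F, F0 `<=` F
  & forall F', sqgood F' -> F `<=` F' -> F' `<=` F].
Proof.
(* The alternative [F = set0] admits the union of the empty chain. *)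
pose P F := sqgood F /\ (F = set0 \/ F0 `<=` F).
have [|F [[gF F0F] Fmax]] := @Zorn_bigcup _ P; last first.
  have {}F0F : F0 `<=` F.
    case: F0F => // F_0; exfalso; apply: (Fmax F0); last by split; [exact: sqgood0|right].
    rewrite F_0; split; first by move=> ?.
    by move=> /(_ (i 0, i 0, i (pickle (0, 0))))[]; exists 0, 0.
  exists F; split=> // F' gF' FF'; apply: contrapT => n; apply: (Fmax F').
    by split.
  by split=> //; right=> p /F0F /FF'.
move=> D DP Dtot; have two p q : (\bigcup_(X in D) X) p -> (\bigcup_(X in D) X) q ->
    exists X, [/\ D X, X p & X q].
  move=> [X DX Xp] [Y DY Yq]; have [XY|YX] := Dtot X Y DX DY.
    by exists Y; split=> //; exact: XY.
  by exists X; split=> //; exact: YX.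
have up X : D X -> sqdom X `<=` sqdom (\bigcup_(X in D) X).
  by move=> DX x [y [z h]]; exists y, z, X.
split; last first.
  have [[X DX F0X]|n] := pselect (exists2 X, D X & F0 `<=` X).
    by right=> p /F0X Xp; exists X.
  left; apply/seteqP; split=> // p [X DX Xp].
  by have [_ [e|F0X]] := DP X DX; [rewrite -e|case: n; exists X].
split.
- move=> x y z z' h h'; have [X [DX Xp Xq]] := two _ _ h h'.
  by have [[h1 _ _ _] _] := DP _ DX; exact: h1 Xp Xq.
- move=> x y x' y' z h h'; have [X [DX Xp Xq]] := two _ _ h h'.
  by have [[_ h1 _ _] _] := DP _ DX; exact: h1 Xp Xq.
- move=> x y [x1 [x2 h]] [y1 [y2 h']]; have [X [DX Xp Xq]] := two _ _ h h'.
  have [[_ _ h1 _] _] := DP _ DX.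
  have [||z Xz] := h1 x y; [by exists x1, x2|by exists y1, y2|].
  by exists z, X.
- move=> x y z [X DX Xp]; have [[_ _ _ h1] _] := DP _ DX.
  by have [? ?] := h1 _ _ _ Xp; split; exact: up DX _ _.
Qed.

(** Take a maximal operation extending the pairing on the image of [nat], with domain [A]. If [A]
    embedded in its complement, the operation would extend to [A] and a disjoint copy; so the
    complement embeds in [A]. *)
Lemma square_inj : exists f : T * T -> T, injective f.
Proof.
have [F [[Ffun Finj Ftot Fcl] F0F Fmax]] := sq_maximal.
set A := sqdom F in Ftot Fcl.
have Ai n : A (i n).
  by exists (i n), (i (pickle (n, n))); apply: F0F; exists n, n.
have /choice[m' mP] : forall p : T * T, exists z, A p.1 -> A p.2 -> F (p.1, p.2, z).
  move=> [x y] /=; have [[Ax Ay]|n] := pselect (A x /\ A y).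
    by have [z Fz] := Ftot x y Ax Ay; exists z.
  by exists x => Ax Ay; case: n.
pose m x y := m' (x, y).
have {}mP x y : A x -> A y -> F (x, y, m x y) by exact: (mP (x, y)).
have mA x y : A x -> A y -> A (m x y) by move=> Ax Ay; case: (Fcl _ _ _ (mP x y Ax Ay)).
have mI x y x' y' : A x -> A y -> A x' -> A y' -> m x y = m x' y' -> x = x' /\ y = y'.
  move=> Ax Ay Ax' Ay' e; have := mP x y Ax Ay; rewrite e => h.
  exact: Finj h (mP _ _ Ax' Ay').
have [[h hI hB]|[h hI hA]] := set_comparison A (~` A).
  exfalso; have {}hB x : A x -> ~ A (h x) by move=> Ax; apply: hB; rewrite in_setE.
  have {}hI x y : A x -> A y -> h x = h y -> x = y.
    by move=> Ax Ay; apply: hI; rewrite in_setE.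
  pose AB := A `|` h @` A; pose tag x : bool := `[< A x >].
  have /choice[bs bsP] : forall x, exists y, AB x -> A y /\ x = if tag x then y else h y.
    move=> x; have [[Ax|[y Ay yx]]|n] := pselect (AB x); last by exists x.
      by exists x => _; rewrite /tag asboolT.
    by exists y => _; rewrite /tag asboolF// -yx; exact: hB.
  have bsA x : AB x -> A (bs x) by move=> /bsP[].
  have bsI x y : AB x -> AB y -> tag x = tag y -> bs x = bs y -> x = y.
    by move=> /bsP[_ ex] /bsP[_ ey] t b; rewrite ex ey t b.
  (* An element of [AB] amounts to a tag and a base point in [A]. Two of them are packed into one
     element of [A], and applying [h] to it gives a new value outside [A], hence distinct from all
     old values. *)
  pose code x y := m (i (pickle (tag x, tag y))) (m (bs x) (bs y)).
  have codeA x y : AB x -> AB y -> A (code x y).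
    by move=> ABx ABy; apply: (mA) => //; apply: (mA); exact: (bsA).
  pose N := [set p : T * T * T | [/\ AB p.1.1, AB p.1.2, ~ (A p.1.1 /\ A p.1.2)
    & p.2 = h (code p.1.1 p.1.2)]].
  have NI x y x' y' z : N (x, y, z) -> N (x', y', z) -> x = x' /\ y = y'.
    move=> [/= ABx ABy _ ->] [/= ABx' ABy' _].
    move=> /hI -/(_ (codeA _ _ ABx ABy) (codeA _ _ ABx' ABy')).
    move=> /mI[]//; try exact: mA (bsA _ _) (bsA _ _).
    move=> /iI /(pcan_inj pickleK)[tx ty] /mI[]; try exact: bsA.
    by move=> ex ey; split; exact: bsI.
  have FA x y z : F (x, y, z) -> [/\ A x, A y & A z].
    by move=> Fxyz; have [Ay Az] := Fcl _ _ _ Fxyz; split=> //; exists y, z.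
  have NnA z x y : N (x, y, z) -> ~ A z.
    by move=> [/= ABx ABy _ ->]; apply: hB; exact: codeA.
  have ABz x y z : N (x, y, z) -> AB z.
    by move=> [/= ABx ABy _ ->]; right; exists (code x y) => //; exact: codeA.
  have tot x y : AB x -> AB y -> exists z, (F `|` N) (x, y, z).
    move=> ABx ABy; have [[Ax Ay]|n] := pselect (A x /\ A y).
      by exists (m x y); left; exact: mP.
    by exists (h (code x y)); right.
  have domE : sqdom (F `|` N) = AB.
    apply/seteqP; split=> [x [y [z [/FA[Ax _ _]|[]//]]]|x ABx]; first by left.
    by have [z hz] := tot x x ABx ABx; exists x, z.
  have sub : F `|` N `<=` F.
    apply: Fmax; last by move=> ? ?; left.
    split; rewrite ?domE //.
    - move=> x y z z' [Fz|Nz] [Fz'|Nz'].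
      + exact: Ffun Fz Fz'.
      + by have [? ? _] := FA _ _ _ Fz; have [_ _ []] := Nz'.
      + by have [? ? _] := FA _ _ _ Fz'; have [_ _ []] := Nz.
      + by have [_ _ _ /= ->] := Nz; have [_ _ _ /= ->] := Nz'.
    - move=> x y x' y' z [Fz|Nz] [Fz'|Nz'].
      + exact: Finj Fz Fz'.
      + by have [_ _ /(NnA _ _ _ Nz')] := FA _ _ _ Fz.
      + by have [_ _ /(NnA _ _ _ Nz)] := FA _ _ _ Fz'.
      + exact: NI Nz Nz'.
    - move=> x y z [Fz|Nz].
        by have [_ Ay Az] := FA _ _ _ Fz; split; left.
      by split; [case: Nz|exact: ABz Nz].
  have ABh : AB (h (i 0)) by right; exists (i 0).
  have [z hz] := tot _ _ ABh ABh.
  by have [/(hB _ (Ai 0))] := FA _ _ _ (sub _ hz).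
have {}hA x : ~ A x -> A (h x) by move=> nAx; apply: hA; rewrite in_setE.
(* The whole type embeds in [A], with [i 0] and [i 1] marking the two halves. *)
pose g x := if `[< A x >] then m (i 0) x else m (i 1) (h x).
have gA x : A (g x) by rewrite /g; case: asboolP => Ax; apply: mA => //; exact: hA.
have gI : injective g.
  move=> x y; rewrite /g; case: asboolP => Ax; case: asboolP => Ay.
  - by move=> /mI[].
  - by move=> /mI[]// ; [exact: hA|move=> /iI].
  - by move=> /mI[]// ; [exact: hA|move=> /iI].
  - move=> /mI[]//; try exact: hA.
    by move=> _ /hI; apply; rewrite in_setE.
exists (fun p => m (g p.1) (g p.2)) => -[x y] [x' y'] /= /mI[]//.
by move=> /gI -> /gI ->.
Qed.

Lemma seq_inj : exists f : seq T -> T, injective f.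
Proof.
have [f fI] := square_inj.
pose c (l : seq T) := foldr (fun x a => f (x, a)) (i 0) l.
(* The length is stored too, since [c] alone may identify lists of different lengths. *)
exists (fun l => f (i (size l), c l)) => l l' /fI[/iI + e].
elim: l l' e => [|x l IH] [|x' l'] //= /fI[-> e] [s].
by rewrite (IH l').
Qed.

End Square.

(** * Downward Löwenheim–Skolem *)

Section SubFrame.
Variables (G : groupType) (S V : set G).
Hypotheses (hS : coxeter_system S) (fr : frame S V).
Implicit Types (a b s : G).

(* The generators of the subdivision of the clique spanned by [V']. *)
Definition span (V' : set G) : set G :=
  [set s | S s /\ forall a, V a -> commute s a -> V' a].

Lemma span_frame V' : V' `<=` V -> four V' -> frame (span V') V'.
Proof.
move=> V'V V'4; have VS := fr_sub fr.
have nV c : span V' c -> ~ V' c -> ~ V c.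
  by move=> [_ h] n Vc; apply: n; exact: h.
split=> //.
- move=> a V'a; have Va := V'V _ V'a; split; first exact: VS.
  by move=> b Vb ab; rewrite -(fr_VV fr Va Vb ab).
- by move=> a b /V'V Va /V'V Vb; exact: (fr_VV fr).
- by move=> c d sc nc sd nd; apply: (fr_EE fr); [case: sc|exact: nV|case: sd|exact: nV].
- move=> a b V'a V'b ab; have [Va Vb] := (V'V _ V'a, V'V _ V'b).
  have [c [Sc Vc ca cb]] := fr_edge fr Va Vb ab.
  exists c; split=> //; last by move/V'V.
  split=> // d Vd cd; have [->//|da] := pselect (d = a).
  have [->//|db] := pselect (d = b).
  by case: (fr_edge3 fr Sc Vc Va Vb Vd ab _ _ ca cb cd); exact: nesym.
- move=> c sc nc; have [Sc h] := sc; have Vc := nV _ sc nc.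
  have [a [b [Va Vb ab [ca cb] hc]]] := fr_ends fr Sc Vc.
  exists a, b; split=> //; [exact: h|exact: h|].
  by move=> d /V'V; exact: hc.
- move=> c d a b sc nc sd nd /V'V Va /V'V Vb.
  by apply: (fr_uniq fr) => //; [case: sc|exact: nV|case: sd|exact: nV].
Qed.

(** On the diagonal [ed a a] is the vertex [a], so pairs of vertices enumerate all generators of a
    span, which bounds their number. *)
Lemma edge_fun : exists ed : G -> G -> G, forall V', V' `<=` V ->
  forall s, span V' s -> exists a b, [/\ V' a, V' b & s = ed a b].
Proof.
have /choice[ed edP] : forall p : G * G, exists c, V p.1 -> V p.2 ->
    if p.1 == p.2 then c = p.1
    else [/\ S c, ~ V c, commute c p.1 & commute c p.2].
  move=> [a b] /=; case: (eqVneq a b) => [_|/eqP ab]; first by exists a.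
  have [[Va Vb]|n] := pselect (V a /\ V b); last by exists a => Va Vb; case: n.
  by have [c hc] := fr_edge fr Va Vb ab; exists c.
exists (fun a b => ed (a, b)) => V' V'V s [Ss hs].
have [Vs|Vs] := pselect (V s).
  have V's : V' s by exact: hs.
  exists s, s; split=> //.
  by have := edP (s, s) Vs Vs; rewrite /= eqxx => ->.
have [a [b [Va Vb ab [sa sb] _]]] := fr_ends fr Ss Vs.
exists a, b; split; [exact: hs|exact: hs|].
have := edP (a, b) Va Vb; rewrite /=; case: eqP => // _ [Sc Vc ca cb].
exact: (fr_uniq fr Ss Vs Sc Vc Va Vb ab).
Qed.

Lemma ends_fun : exists e : G -> seq G, forall s, word_in V (e s) /\
  (S s -> forall a, V a -> commute s a -> a \in e s).
Proof.
suff /choice[e eP] : forall s, exists k, word_in V k /\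
    (S s -> forall a, V a -> commute s a -> a \in k) by exists e.
move=> s; have [Ss|n] := pselect (S s); last by exists [::].
have [Vs|Vs] := pselect (V s).
  exists [:: s]; split; first by apply/word_in_cons.
  by move=> _ a Va sa; rewrite inE (fr_VV fr Vs Va sa).
have [a [b [Va Vb _ _ h]]] := fr_ends fr Ss Vs.
exists [:: a; b]; split.
  by apply/word_in_cons; split=> //; apply/word_in_cons.
by move=> _ d Vd sd; rewrite !inE; case: (h d Vd sd) => ->; rewrite eqxx ?orbT.
Qed.

End SubFrame.

Lemma four_seq (T : eqType) (P : set T) : four P -> exists q : seq T,
  (forall x, x \in q -> P x) /\ four [set` q].
Proof.
move=> fP; have [//|a Pa _] := fP [::]; have [//|b Pb] := fP [:: a].
have [//|c Pc] := fP [:: b; a]; have [//|d Pd] := fP [:: c; b; a].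
move=> d3 c2 b1; exists [:: d; c; b; a]; split.
  by move=> x; rewrite !inE => /or4P[] /eqP ->.
move=> k k3; apply: contrapT => h.
have : size [:: d; c; b; a] <= size k.
  apply: uniq_leq_size; first by rewrite /= d3 c2 b1.
  by move=> x xq; apply: contrapT => /negP xk; apply: h; exists x.
by rewrite leqNgt ltnS k3.
Qed.

(** [V'] consists of the ends of all letters in chosen words for the elements of [X], the four
    vertices [q] that keep the clique large enough, and the default [v0]. A code in [K] decodes to a
    list and a position in it, and positions out of range give [v0]. Generators are coded by pairs
    of codes, elements by lists, and both are brought back to [K]. *)
Lemma K1_LS : LS_property K1 coxeter_le nat.
Proof.
move=> G A X /K1P[S [V [hS fr AS]]] XA.
have [ed edP] := edge_fun fr; have [e eP] := ends_fun fr.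
have [q [qV q4]] := four_seq (fr_four fr).
have [//|v0 Vv0 _] := fr_four fr (k := [::]).
have /choice[w wP] : forall x : X, exists l, word_in S l /\ prodw l = val x.
  move=> x; have : gen S (val x) by rewrite -AS; apply: XA; exact: set_valP.
  by move=> [l Sl lx]; exists l.
pose K := (X + nat)%type.
have inrI : injective (inr : nat -> K) by move=> ? ? [].
have [f fI] := square_inj inrI; have [h hI] := seq_inj inrI.
have /choice[g gP] : forall k : K, exists p : K * K, forall p', f p' = k -> p' = p.
  move=> k; have [[p <-]|n] := pselect (exists p, f p = k); first by exists p => p' /fI.
  by exists (k, k) => p' e'; case: n; exists p'.
pose ls (z : K) : seq G := if z is inl x then flatten (map e (w x)) else q.
pose nt (z : K) : nat := if z is inr n then n else 0.
pose v (k : K) : G := nth v0 (ls (g k).1) (nt (g k).2).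
pose V' : set G := range v.
have lsV z : word_in V (ls z).
  case: z => [x|n] /=; last exact: qV.
  by move=> a /flatten_mapP[s sw ae]; have [eV _] := eP s; exact: eV.
have V'V : V' `<=` V.
  move=> _ [k _ <-]; rewrite /v; set l := ls _; set n := nt _.
  have [nl|nl] := ltnP n (size l); first by apply: (lsV (g k).1); rewrite mem_nth.
  by rewrite nth_default.
have lsV' z a : a \in ls z -> V' a.
  move=> az; exists (f (z, inr (index a (ls z)))) => //.
  by rewrite /v -(gP _ _ erefl) /= nth_index.
have V'4 : four V' by apply: four_sub q4 => a aq; exact: (lsV' (inr 0)).
pose S' := span S V V'; have fr' := span_frame fr V'V V'4.
have S'S : S' `<=` S by move=> s [].
have hS' := cox_sub hS S'S.
exists (gen S'); split.
- by apply/K1P; exists S', V'.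
- move=> x Xx; pose x' : X := exist _ x (mem_set Xx).
  have [Sl lx] := wP x'; exists (w x') => // s sw; split; first exact: Sl.
  move=> a Va sa; apply: (lsV' (inl x')); apply/flatten_mapP; exists s => //.
  by have [_ es] := eP s; apply: es => //; exact: Sl.
- by rewrite AS; exact: le_of_sub.
- pose s2 (k : K) := ed (v (g k).1) (v (g k).2).
  have s2P s : S' s -> exists k, s2 k = s.
    move=> /(edP V' V'V)[a [b [[k _ <-] [k' _ <-] ->]]].
    by exists (f (k, k')); rewrite /s2 -(gP _ _ erefl).
  have sub : gen S' `<=` [set prodw (map s2 l) | l in [set: seq K]].
    move=> _ [l S'l <-]; suff [k kl] : exists k, map s2 k = l by exists k; rewrite ?kl.
    elim: l S'l => [|s l IH]; first by exists [::].
    by move=> /word_in_cons[/s2P[k <-] /IH[ks <-]]; exists (k :: ks).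
  apply: card_le_trans (subset_card_le sub) _.
  apply: card_le_trans (card_image_le _ _) _.
  have hI' : {in [set: seq K] &, injective h} by move=> ? ? _ _; exact: hI.
  by rewrite -(card_le_eql (inj_card_eq hI')); exact: card_leT.
Qed.

Lemma K1_LS_number : LS_number K1 coxeter_le nat.
Proof.
split; [exact: infinite_nat|exact: K1_LS|].
by move=> lambda inf _; apply/infiniteP.
Qed.

(** * Amalgamation *)

Section Universal.
Variable Y : choiceType.

(* The right-angled Coxeter group on all subsets of [Y], two of them        *)
(* commuting when one contains the other.  Its generators indexed by the    *)
(* subsets with one or two elements form the subdivision of a clique.       *)
Definition univ : groupType := racg (fun z z' : set Y => z `<=` z').

Definition ulet (z : set Y) : univ := rletter (fun z z' : set Y => z `<=` z') z.

Definition ubase : set univ := [set ulet [set x; y] | x in [set: Y] & y in [set: Y]].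

Definition uvert : set univ := [set ulet [set x] | x in [set: Y]].

Lemma ulet_inj : injective ulet.
Proof. exact: rletter_inj. Qed.

Lemma ulet_commute z z' : commute (ulet z) (ulet z') <-> z `<=` z' \/ z' `<=` z.
Proof.
split=> [/rletter_commuteP[->|zz'|zz']|[zz'|zz']]; [by left|by left|by right| |].
  exact: rletter_commute.
by apply/commute_sym; exact: rletter_commute.
Qed.

Lemma ulet_system (P : set (set Y)) : coxeter_system (ulet @` P).
Proof.
by apply: (cox_sub (rletter_system (fun z z' : set Y => z `<=` z'))) => _ [z _ <-];
  exists z.
Qed.

Lemma ubaseE : ubase = ulet @` [set z | exists x y, z = [set x; y]].
Proof.
apply/seteqP; split=> [_ [x _ [y _ <-]]|_ [_ [x [y ->]] <-]].
  by exists [set x; y] => //; exists x, y.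
by exists x => //; exists y.
Qed.

Lemma ubase_system : coxeter_system ubase.
Proof. by rewrite ubaseE; exact: ulet_system. Qed.

Lemma ubase_vert x : ubase (ulet [set x]).
Proof. by exists x => //; exists x; rewrite // setUid. Qed.

Lemma ubase_nvert x y : ~ uvert (ulet [set x; y]) -> x <> y.
Proof. by move=> n e; apply: n; exists x; rewrite // e setUid. Qed.

Lemma uvert_edge x y : x <> y -> ~ uvert (ulet [set x; y]).
Proof.
move=> xy [z _ /ulet_inj e]; apply: xy.
have : [set z] x by rewrite e; left.
have : [set z] y by rewrite e; right.
by move=> -> ->.
Qed.

Lemma uvert_commute x y z : x <> y ->
  commute (ulet [set x; y]) (ulet [set z]) <-> z = x \/ z = y.
Proof.
move=> xy; rewrite ulet_commute; split=> [[h|h]|h].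
- have ex : x = z by apply: h; left.
  have ey : y = z by apply: h; right.
  by case: xy; rewrite ex ey.
- exact: (h z).
- by right=> _ ->.
Qed.

Lemma ubase_frame : four [set: Y] -> frame ubase uvert.
Proof.
move=> Y4; split.
- by move=> _ [x _ <-]; exact: ubase_vert.
- by apply: four_image Y4 => x y _ _ /ulet_inj e; have : [set y] x by rewrite -e.
- move=> _ _ [x _ <-] [y _ <-] /ulet_commute[h|h]; congr ulet.
    by rewrite (h x erefl).
  by rewrite (h y erefl).
- move=> _ _ [x _ [y _ <-]] /ubase_nvert xy [x' _ [y' _ <-]] /ubase_nvert xy'.
  have pair a b c d : a <> b -> [set a; b] `<=` [set c; d] -> [set a; b] = [set c; d].
    move=> ab h; have ha : [set c; d] a by apply: h; left.
    have hb : [set c; d] b by apply: h; right.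
    case: ha hb => /= ea [] /= eb.
    - by case: ab; rewrite ea eb.
    - by rewrite ea eb.
    - by rewrite ea eb setUC.
    - by case: ab; rewrite ea eb.
  by move=> /ulet_commute[] h; congr ulet; [|apply/esym]; exact: pair.
- move=> _ _ [x _ <-] [y _ <-] nxy.
  have xy : x <> y by move=> e; apply: nxy; rewrite e.
  exists (ulet [set x; y]); split; [by exists x => //; exists y|exact: uvert_edge| |].
    by apply/uvert_commute => //; left.
  by apply/uvert_commute => //; right.
- move=> _ [x _ [y _ <-]] /ubase_nvert xy.
  exists (ulet [set x]), (ulet [set y]); split; [by exists x|by exists y| | |].
  + by move=> /ulet_inj e; apply: xy; have : [set y] x by rewrite -e.
  + by split; apply/uvert_commute => //; [left|right].
  + by move=> _ [z _ <-] /(uvert_commute _ xy)[->|->]; [left|right].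
- move=> c0 d0 a0 b0 [x _ [y _ <-]] /ubase_nvert xy [x' _ [y' _ <-]] /ubase_nvert xy'.
  move=> [a _ <-] [b _ <-] nab.
  have ab : a <> b by move=> e; apply: nab; rewrite e.
  move=> /(uvert_commute _ xy) ax /(uvert_commute _ xy) bx.
  move=> /(uvert_commute _ xy') ax' /(uvert_commute _ xy') bx'; congr ulet.
  have pair c d : a = c \/ a = d -> b = c \/ b = d -> [set c; d] = [set a; b].
    move=> [] ea [] eb.
    - by case: ab; rewrite ea eb.
    - by rewrite ea eb.
    - by rewrite ea eb setUC.
    - by case: ab; rewrite ea eb.
  by rewrite (pair x y)// (pair x' y').
Qed.

Lemma K1_univ : four [set: Y] -> K1 (gen ubase).
Proof.
by move=> Y4; apply/K1P; exists ubase, uvert; split=> //;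
  [exact: ubase_system|exact: ubase_frame].
Qed.

End Universal.

(** A singleton for a vertex, which commutes with itself, and the two ends for an edge. Containment
    of these sets expresses commutation, as for the letters of [univ]. *)
Definition nbhd (G : groupType) (V : set G) (s : G) : set G :=
  [set a | V a /\ commute s a].

Section Embedding.
Variables (G : groupType) (S V : set G) (Y : choiceType) (i : G -> Y).
Hypotheses (hS : coxeter_system S) (fr : frame S V) (iI : set_inj V i).
Implicit Types (s t a b : G).

Lemma nbhd_vertex a : V a -> nbhd V a = [set a].
Proof.
move=> Va; apply/seteqP; split=> [b [Vb ab]|_ ->]; last by split.
by rewrite -(fr_VV fr Va Vb ab).
Qed.

Lemma nbhd_edge s : S s -> ~ V s -> exists a b,
  [/\ V a, V b, a <> b & nbhd V s = [set a; b]].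
Proof.
move=> Ss Vs; have [a [b [Va Vb ab [sa sb] h]]] := fr_ends fr Ss Vs.
exists a, b; split=> //; apply/seteqP; split=> [d [Vd /(h d Vd)]//|d].
by case=> ->.
Qed.

Lemma nbhd_inj s t : S s -> S t -> nbhd V s = nbhd V t -> s = t.
Proof.
have key s' t' : S s' -> V t' -> nbhd V s' = nbhd V t' -> s' = t'.
  move=> Ss Vt; rewrite (nbhd_vertex Vt) => e.
  have [Vs|Vs] := pselect (V s').
    by have : [set t'] s' by rewrite -e; split.
  have [a [b [_ _ ab eab]]] := nbhd_edge Ss Vs; case: ab; rewrite eab in e.
  have -> : a = t' by rewrite -[_ = _]/([set t'] a) -e; left.
  by apply/esym; rewrite -[_ = _]/([set t'] b) -e; right.
move=> Ss St e; have [Vt|Vt] := pselect (V t); first exact: key.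
have [Vs|Vs] := pselect (V s); first exact/esym/key.
have [a [b [Va Vb ab eab]]] := nbhd_edge Ss Vs.
have [_ sa] : nbhd V s a by rewrite eab; left.
have [_ sb] : nbhd V s b by rewrite eab; right.
rewrite e in eab; have [_ ta] : nbhd V t a by rewrite eab; left.
have [_ tb] : nbhd V t b by rewrite eab; right.
exact: (fr_uniq fr Ss Vs St Vt Va Vb ab).
Qed.

Lemma nbhd_commute s t : S s -> S t -> commute s t <->
  nbhd V s `<=` nbhd V t \/ nbhd V t `<=` nbhd V s.
Proof.
have VS := fr_sub fr.
have key s' t' : V s' -> S t' -> commute s' t' <-> nbhd V s' `<=` nbhd V t'.
  move=> Vs St; rewrite (nbhd_vertex Vs); split=> [c _ ->|h].
    by split=> //; exact: commute_sym.
  by apply: commute_sym; have [] := h s' erefl.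
move=> Ss St; split.
  move=> c; have [Vs|Vs] := pselect (V s); first by left; apply/key.
  have [Vt|Vt] := pselect (V t); first by right; apply/key => //; exact: commute_sym.
  by rewrite (fr_EE fr Ss Vs St Vt c); left.
suff sub s' t' : S s' -> S t' -> nbhd V s' `<=` nbhd V t' -> commute s' t'.
  by case=> h; [|apply: commute_sym]; exact: sub.
move=> {}Ss {}St h; have [Vs|Vs] := pselect (V s'); first exact/key.
have [a [b [Va Vb ab eab]]] := nbhd_edge Ss Vs.
have [_ sa] : nbhd V s' a by rewrite eab; left.
have [_ sb] : nbhd V s' b by rewrite eab; right.
have [_ ta] : nbhd V t' a by apply: h; rewrite eab; left.
have [_ tb] : nbhd V t' b by apply: h; rewrite eab; right.
have [Vt|Vt] := pselect (V t').
  by case: ab; rewrite -(fr_VV fr Vt Va ta) -(fr_VV fr Vt Vb tb).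
by rewrite (fr_uniq fr Ss Vs St Vt Va Vb ab sa sb ta tb).
Qed.

Lemma image_sub_inj (P Q : set G) : P `<=` V -> Q `<=` V -> i @` P `<=` i @` Q -> P `<=` Q.
Proof.
move=> PV QV h x Px; have [y Qy yx] := h _ (ex_intro2 _ _ x Px erefl).
by rewrite -(iI (mem_set (QV _ Qy)) (mem_set (PV _ Px)) yx).
Qed.

Let theta s : univ Y := ulet (i @` nbhd V s).

Lemma theta_commute s t : S s -> S t ->
  commute (theta s) (theta t) <-> commute s t.
Proof.
move=> Ss St; have nV u : nbhd V u `<=` V by move=> ? [].
rewrite ulet_commute nbhd_commute//; split=> -[h|h].
- by left; exact: image_sub_inj h.
- by right; exact: image_sub_inj h.
- by left; exact: image_subset.
- by right; exact: image_subset.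
Qed.

Lemma theta_inj s t : S s -> S t -> theta s = theta t -> s = t.
Proof.
move=> Ss St /ulet_inj e; apply: nbhd_inj => //.
have nV u : nbhd V u `<=` V by move=> ? [].
by apply/seteqP; split; apply: image_sub_inj => //; rewrite e.
Qed.

Lemma theta_base s : S s -> ubase (theta s).
Proof.
move=> Ss; rewrite /theta; have [Vs|Vs] := pselect (V s).
  by rewrite nbhd_vertex// image_set1; exact: ubase_vert.
have [a [b [_ _ _ ->]]] := nbhd_edge Ss Vs.
by rewrite image_setU !image_set1; exists (i a) => //; exists (i b).
Qed.

(** Injectivity also follows by lifting: the inverse on generators extends to a morphism [g] with
    [g (f x) = x]. The values on generators are kept for comparing two embeddings in the amalgam. *)
Lemma embed_univ : exists2 f : G -> univ Y,
  strong_embedding coxeter_le (gen S) (gen (@ubase Y)) f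
  & forall s, S s -> f s = ulet (i @` nbhd V s).
Proof.
have [||f fM fE] := @lift_system _ _ S theta hS.
- by move=> s Ss; apply: (cox_sq (@ubase_system Y)); exact: theta_base.
- by move=> s t Ss St st; apply/theta_commute.
have sub : f @` S `<=` @ubase Y.
  by move=> _ [s Ss <-]; rewrite fE//; exact: theta_base.
exists f => //; split=> //; last first.
  by rewrite -(gen_image fM); apply: le_of_sub => //; exact: ubase_system.
have hT := cox_sub (@ubase_system Y) sub.
have /choice[k kP] : forall y, exists s, (f @` S) y -> S s /\ f s = y.
  move=> y; have [[s Ss sy]|n] := pselect ((f @` S) y); first by exists s.
  by exists 1.
have kK s : S s -> k (f s) = s.
  move=> Ss; have [Sk] := kP (f s) (ex_intro2 _ _ s Ss erefl).
  by rewrite (fE _ Sk) => e; apply: theta_inj => //; rewrite e; exact: fE.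
have [||g gM gE] := @lift_system _ _ (f @` S) k hT.
- by move=> _ [s Ss <-]; rewrite kK//; exact: (cox_sq hS).
- move=> _ _ [s Ss <-] [t St <-]; rewrite !kK// !fE// => /theta_commute; exact.
have gfK x : gen S x -> g (f x) = x.
  move=> [l Sl <-]; rewrite (morph_prodw fM Sl) (morph_prodw gM).
    rewrite -map_comp -[in RHS](map_id l); congr prodw; apply/eq_in_map => s sl /=.
    by rewrite gE ?kK//; [exact: Sl|exists s => //; exact: Sl].
  by move=> _ /mapP[s sl ->]; exists s => //; exact: Sl.
by move=> x y; rewrite !in_setE => gx gy e; rewrite -(gfK x)// e gfK.
Qed.

End Embedding.

Lemma four_inj (T U : choiceType) (P : set T) (i : T -> U) : four P ->
  set_inj P i -> four [set: U].
Proof. by move=> P4 iI; apply: four_sub (four_image iI P4). Qed.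

Lemma K1_joint_embedding : joint_embedding K1 coxeter_le.
Proof.
move=> G1 G2 B C /K1P[S [V [hS fr ->]]] /K1P[T [W [hT fr' ->]]].
pose Y : choiceType := (G1 + G2)%type.
have lI : set_inj V (inl : G1 -> Y) by move=> ? ? _ _ [].
have rI : set_inj W (inr : G2 -> Y) by move=> ? ? _ _ [].
have [f fE _] := embed_univ hS fr lI; have [g gE _] := embed_univ hT fr' rI.
exists (univ Y), (gen (@ubase Y)), f, g; split=> //.
by apply: K1_univ; exact: four_inj (fr_four fr) lI.
Qed.

Lemma K1_large : arbitrarily_large K1.
Proof.
move=> X; pose Y : choiceType := ({classic X} + 'I_4)%type.
exists (univ Y), (gen (@ubase Y)); split.
  by apply: K1_univ; apply: (@four_inj _ Y _ inr four_ord) => ? ? _ _ [].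
pose f (x : X) : univ Y := @ulet Y [set inl x].
have fI : {in [set: X] &, injective f}.
  move=> x y _ _ /ulet_inj e; have : [set (inl y : Y)] (inl x) by rewrite -e.
  by case.
rewrite -(card_le_eql (inj_card_eq fI)); apply: subset_card_le => _ [x _ <-].
by apply: gen_mem; exact: ubase_vert.
Qed.

(** A vertex commutes with no other vertex, and an edge already has its two ends in the smaller
    frame. Thus the letter of [univ] attached to a generator of [A] can be computed in either
    extension of [A]. *)
Lemma nbhd_extend (G H : groupType) (S V : set G) (T W : set H) (f : G -> H) s :
  frame S V -> frame T W -> morph_on (gen S) f -> set_inj (gen S) f ->
  f @` S `<=` T -> S s -> nbhd W (f s) = f @` nbhd V s.
Proof.
move=> fr fr' fM fI fT Ss; have ff := frame_image fM fI fr.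
have VW := frame_vertices ff fr' fT; have VS := fr_sub fr.
have sub : f @` nbhd V s `<=` nbhd W (f s).
  move=> _ [a [Va sa] <-]; split; first by apply: VW; exists a.
  by apply: (morph_commute fM) => //; apply: gen_mem => //; exact: VS.
apply/seteqP; split=> // b [Wb sb].
have [Vs|Vs] := pselect (V s).
  have Wfs : W (f s) by apply: VW; exists s.
  by exists s; [split|exact: (fr_VV fr')].
have nWs : ~ W (f s).
  move=> Wfs; have [|v Vv] := frame_edges ff fr' fT (t := f s).
    by split=> //; exists s.
  move=> /(morph_inj fI (gen_mem (VS _ Vv)) (gen_mem Ss)) e.
  by apply: Vs; rewrite -e.
have [a [d [Va Vd ad [sa sd] _]]] := fr_ends fr Ss Vs.
have [_ fsa] : nbhd W (f s) (f a) by apply: sub; exists a.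
have [_ fsd] : nbhd W (f s) (f d) by apply: sub; exists d.
have Tfs : T (f s) by apply: fT; exists s.
have Wa : W (f a) by apply: VW; exists a.
have Wd : W (f d) by apply: VW; exists d.
have fad : f a <> f d.
  by move=> /(morph_inj fI (gen_mem (VS _ Va)) (gen_mem (VS _ Vd))).
have [->|ba] := pselect (b = f a); first by exists a.
have [->|bd] := pselect (b = f d); first by exists d.
by case: (fr_edge3 fr' Tfs nWs Wa Wd Wb fad _ _ fsa fsd sb); exact: nesym.
Qed.

(** An embedding from [embed_univ] is determined by the labels of the vertices, so labelling the
    vertices of [A] alike in [B] and [C] makes the square commute, by [nbhd_extend]. *)
Lemma K1_amalgamation : amalgamation K1 coxeter_le.
Proof.
move=> G0 G1 G2 A B C f g KA KB KC [fM fI fle] [gM gI gle].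
have /K1P[S [V [hS fr AS]]] := KA.
have KfA := K1_image KA fM fI; have KgA := K1_image KA gM gI.
rewrite AS in fM fI fle gM gI gle KfA KgA.
have [T [hT BT fT]] := le_extend KfA fle (system_image hS fM fI) (esym (gen_image fM)).
have [T' [hT' CT gT]] := le_extend KgA gle (system_image hS gM gI) (esym (gen_image gM)).
have [W frT] := K1_frame KB hT BT; have [W' frT'] := K1_frame KC hT' CT.
have VS := fr_sub fr.
have VW := frame_vertices (frame_image gM gI fr) frT' gT.
pose Y : choiceType := (G1 + G2)%type.
(* The vertices of [C] coming from [A] are identified with those of [B]. *)
have /choice[j jP] : forall c : G2, exists y : Y,
    (forall a, V a -> g a = c -> y = inl (f a)) /\
    (~ (g @` V) c -> y = inr c).
  move=> c; have [[a Va ac]|n] := pselect ((g @` V) c); last first.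
    by exists (inr c); split=> // a Va ac; case: n; exists a.
  exists (inl (f a)); split=> [a' Va' a'c|[]]; last by exists a.
  congr (inl (f _)); apply: (morph_inj gI); try exact/gen_mem/VS.
  by rewrite a'c.
have jI : set_inj W' j.
  move=> c c' _ _; have [[a Va ac]|n] := pselect ((g @` V) c);
    have [[a' Va' ac']|n'] := pselect ((g @` V) c').
  - rewrite ((jP c').1 a' Va' ac') ((jP c).1 a Va ac).
    move=> [/(morph_inj fI (gen_mem (VS _ Va)) (gen_mem (VS _ Va'))) e].
    by rewrite -ac -ac' e.
  - by rewrite ((jP c).1 a Va ac) ((jP c').2 n').
  - by rewrite ((jP c').1 a' Va' ac') ((jP c).2 n).
  - by rewrite ((jP c).2 n) ((jP c').2 n') => -[].
have lI : set_inj W (inl : G1 -> Y) by move=> ? ? _ _ [].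
have [f' f'S f'E] := embed_univ hT frT lI.
have [g' g'S g'E] := embed_univ hT' frT' jI.
exists (univ Y), (gen (@ubase Y)), f', g'; rewrite BT CT; split=> //.
  by apply: K1_univ; exact: four_inj (fr_four frT) lI.
have eS s : S s -> f' (f s) = g' (g s).
  move=> Ss; rewrite f'E ?g'E; [|by apply: gT; exists s|by apply: fT; exists s].
  rewrite (nbhd_extend fr frT fM fI fT Ss) (nbhd_extend fr frT' gM gI gT Ss).
  congr ulet; apply/seteqP; split=> [_ [_ [a [Va sa] <-] <-]|_ [_ [a [Va sa] <-] <-]].
    by exists (g a); [exists a|rewrite ((jP _).1 a Va erefl)].
  by exists (f a); [exists a|rewrite ((jP _).1 a Va erefl)].
have [f'M _ _] := f'S; have [g'M _ _] := g'S.
move=> x; rewrite in_setE AS => -[l Sl <-] /=.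
rewrite (morph_prodw fM Sl) (morph_prodw gM Sl).
have fw : word_in T (map f l).
  by move=> _ /mapP[s sl ->]; apply: fT; exists s => //; exact: Sl.
have gw : word_in T' (map g l).
  by move=> _ /mapP[s sl ->]; apply: gT; exists s => //; exact: Sl.
rewrite (morph_prodw f'M fw) (morph_prodw g'M gw) -!map_comp; congr prodw.
by apply/eq_in_map => s sl /=; apply: eS; exact: Sl.
Qed.

Lemma K1_AEC : is_AEC K1 coxeter_le.
Proof.
split.
- by move=> G A /K1P[S [V [hS _ ->]]]; exact: gen_subgroup.
- move=> G H A B f fiso KA; rewrite (group_iso_image fiso).
  by case: fiso => fM [_ fI _]; exact: K1_image.
- move=> G H A B C f KA KB fiso AB; rewrite (group_iso_image fiso).
  by case: fiso => fM [_ fI _]; exact: le_image.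
- by move=> G A B _ _ [].
- by move=> G A; exact: K1_le_refl.
- by move=> G A B _ _ [_ _ AB _] [_ _ BA _]; apply/seteqP.
- by move=> G A B C; exact: K1_le_trans.
- move=> I R G A [i0] wo [KA chain _]; apply: (K1_chain i0 KA) => i j.
  have [->|/chain|/chain] := well_order_total i j wo; [|by left|by right].
  by left; exact: K1_le_refl.
- by move=> G A B C; exact: K1_coherent.
- by exists nat; exact: K1_LS_number.
Qed.

Theorem theorem5p10 : finitary_AEC K1 coxeter_le.
Proof.
split.
- exact: K1_AEC.
- exact: K1_LS_number.
- exact: K1_large.
- exact: K1_amalgamation.
- exact: K1_joint_embedding.
- exact: K1_finite_character.
Qed.
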